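(* Let $1\le p<\infty$, $0\le\sigma<1$, let $X_1,\dots,X_m,Y$ be Banach spaces and $T\in\mathcal L(X_1,\dots,X_m;Y)$. The following assertions are equivalent. (1) $T$ is factorable strongly $(p,\sigma)$-continuous. (2) There are a constant $C>0$ and a regular Borel probability measure $\eta$ on $B_{(X_1\widehat\otimes_\pi\cdots\widehat\otimes_\pi X_m)^*}=B_{\mathcal L(X_1,\dots,X_m)}$ such that for all $n\in\mathbb N$, $x^{j,k}\in X_j$ and $\lambda^k\in\mathbb R$ ($j=1,\dots,m$, $k=1,\dots,n$), $$\Big\|\sum_{k=1}^n\lambda^kT(x^{1,k},\dots,x^{m,k})\Big\|\le C\Big(\int_{B_{\mathcal L(X_1,\dots,X_m)}}\Big|\sum_{k=1}^n|\lambda^k|\,|\varphi(x^{1,k}\otimes\cdots\otimes x^{m,k})|^{1-\sigma}\prod_{j=1}^m\|x^{j,k}\|^\sigma\Big|^{\frac p{1-\sigma}}d\eta(\varphi)\Big)^{\frac{1-\sigma}p}.$$ (3) There are a regular Borel probability measure $\eta$ on $B_{\mathcal L(X_1,\dots,X_m)}$, with associated domination space $L_{p,\sigma}(\eta)$, and a continuous linear operator $\hat T:L_{p,\sigma}(\eta)\to Y$ such that $T=\hat T\circ i_{p,\sigma}\circ i$.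
   Context: $\mathcal L(X_1,\dots,X_m;Y)$ is the space of continuous $m$-linear mappings; $\mathcal L(X_1,\dots,X_m)$ is the case of scalar values, identified with the dual of the projective tensor product $X_1\widehat\otimes_\pi\cdots\widehat\otimes_\pi X_m$ via $\varphi(x^1\otimes\cdots\otimes x^m)=\varphi(x^1,\dots,x^m)$; its closed unit ball $B_{\mathcal L(X_1,\dots,X_m)}$ carries the weak* topology (compact Hausdorff). $i:X_1\times\cdots\times X_m\to C(B_{\mathcal L(X_1,\dots,X_m)})$ is $i(x^1,\dots,x^m)=\langle x^1\otimes\cdots\otimes x^m,\cdot\rangle$, the function $\varphi\mapsto\varphi(x^1,\dots,x^m)$, and $V_m$ is the linear span of its range, a space of continuous functions algebraically identified with the algebraic tensor product $X_1\otimes\cdots\otimes X_m$. $T$ is factorable strongly $(p,\sigma)$-continuous if there is $C>0$ such that for all $n_1,n_2\in\mathbb N$, $x_i^{j,k}\in X_j$ and scalars $\lambda_i^k$ ($1\le j\le m$, $1\le i\le n_1$, $1\le k\le n_2$), $$\Big(\sum_{i=1}^{n_1}\Big\|\sum_{k=1}^{n_2}\lambda_i^kT(x_i^{1,k},\dots,x_i^{m,k})\Big\|^{\frac p{1-\sigma}}\Big)^{\frac{1-\sigma}p}\le C\sup_{\varphi\in B_{\mathcal L(X_1,\dots,X_m)}}\Big(\sum_{i=1}^{n_1}\Big|\sum_{k=1}^{n_2}|\lambda_i^k|\,|\varphi(x_i^{1,k},\dots,x_i^{m,k})|^{1-\sigma}\prod_{j=1}^m\|x_i^{j,k}\|^\sigma\Big|^{\frac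 p{1-\sigma}}\Big)^{\frac{1-\sigma}p}.$$ $L_{p,\sigma}(\eta)$: on $V_m$ consider the seminorm $$\Big\|\sum_{k=1}^n\lambda^k\langle x^{1,k}\otimes\cdots\otimes x^{m,k},\cdot\rangle\Big\|_{p,\sigma}=\inf\sum_{i=1}^r\Big(\int_{B_{\mathcal L(X_1,\dots,X_m)}}\Big|\sum_{k=1}^{s}|\lambda_i^k|\,|\langle x_i^{1,k}\otimes\cdots\otimes x_i^{m,k},\varphi\rangle|^{1-\sigma}\prod_{j=1}^m\|x_i^{j,k}\|^\sigma\Big|^{\frac p{1-\sigma}}d\eta(\varphi)\Big)^{\frac{1-\sigma}p},$$ where the infimum is over all finite representations $\sum_{k=1}^n\lambda^kx^{1,k}\otimes\cdots\otimes x^{m,k}=\sum_{i=1}^r\sum_{k=1}^{s}\lambda_i^kx_i^{1,k}\otimes\cdots\otimes x_i^{m,k}$ (with $r,s\in\mathbb N$ arbitrary). $L_{p,\sigma}(\eta)$ is the completion of the quotient of $V_m$ by the kernel of this seminorm, with the induced norm, and $i_{p,\sigma}:V_m\to L_{p,\sigma}(\eta)$ is the quotient map. *)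

(* Defs.v *)
From HB Require Import structures.
From mathcomp Require Import all_boot all_order all_algebra ring_quotient.
From mathcomp Require Import all_classical all_reals all_analysis measurable_realfun.

Set Implicit Arguments.
Unset Strict Implicit.
Unset Printing Implicit Defensive.

Import Order.TTheory GRing.Theory Num.Theory.
Import numFieldNormedType.Exports.

Local Open Scope classical_set_scope.
Local Open Scope ring_scope.

Record seminorm (R : realType) (V : lmodType R) := Seminorm {
  snorm :> V -> R ;
  snormD : forall u v, snorm (u + v) <= snorm u + snorm v ;
  snormZ : forall a u, snorm (a *: u) = `|a| * snorm u }.

(* The completion of (V / ker N, N), as Cauchy sequences of V modulo null
   sequences; ker N is quotiented out because constant sequences with value in
   ker N are null. *)
Section Completion.
Variables (R : realType) (V : lmodType R) (N : seminorm V).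

Lemma snorm0 : N 0 = 0.
Proof. by rewrite -(scale0r 0) snormZ normr0 mul0r. Qed.

Lemma snormN u : N (- u) = N u.
Proof. by rewrite -scaleN1r snormZ normrN1 mul1r. Qed.

Lemma snormB u v : N (u - v) = N (v - u).
Proof. by rewrite -snormN opprB. Qed.

Lemma snorm_ge0 u : 0 <= N u.
Proof.
have := snormD N u (- u).
by rewrite subrr snorm0 snormN -mulr2n pmulrn_lge0.
Qed.

Lemma snorm_trans w u v : N (u - v) <= N (u - w) + N (w - v).
Proof. by rewrite -(subrKA w) snormD. Qed.

Lemma snorm_dist u v : `|N u - N v| <= N (u - v).
Proof.
rewrite ler_distl lerBlDr; apply/andP; split.
  by have := snormD N (v - u) u; rewrite subrK (snormB v) addrC.
by have := snormD N (u - v) v; rewrite subrK addrC.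
Qed.

Definition cauchy_seqs : set (nat -> V) := [set u |
  forall e : R, 0 < e -> exists M, forall n k, (M <= n)%N -> (M <= k)%N ->
    N (u n - u k) < e].

Definition is_cauchy_seq : pred (nat -> V) := fun u => u \in cauchy_seqs.

Lemma is_cauchy_seq_submod_closed : submod_closed is_cauchy_seq.
Proof.
split.
  rewrite /in_mem/= /is_cauchy_seq; apply/mem_set => e e0; exists 0%N => n k _ _.
  by rewrite subrr snorm0.
move=> a u v; rewrite /in_mem/= /is_cauchy_seq => /set_mem cu /set_mem cv.
apply/mem_set => e e0.
have e20 : 0 < e / 2 by rewrite divr_gt0.
have a1 : 0 < `|a| + 1 by rewrite ltr_wpDl.
have [M1 h1] := cu _ (divr_gt0 e20 a1).
have [M2 h2] := cv _ e20.
exists (maxn M1 M2) => n k; rewrite !geq_max => /andP[n1 n2] /andP[k1 k2].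
rewrite (_ : _ - _ = a *: (u n - u k) + (v n - v k)); last first.
  by rewrite scalerBr addrACA -opprD.
rewrite (le_lt_trans (snormD _ _ _))// [ltRHS](splitr e) ler_ltD ?h2//.
rewrite snormZ (@le_trans _ _ ((`|a| + 1) * N (u n - u k)))//.
  by rewrite ler_wpM2r ?snorm_ge0// lerDl.
by rewrite mulrC -ler_pdivlMr// ltW// h1.
Qed.

HB.instance Definition _ :=
  GRing.isSubmodClosed.Build R (nat -> V) is_cauchy_seq is_cauchy_seq_submod_closed.

Definition cauchy_seq := {u : nat -> V | is_cauchy_seq u}.
HB.instance Definition _ := SubChoice.on cauchy_seq.
HB.instance Definition _ := [SubChoice_isSubLmodule of cauchy_seq by <:].

Definition null_seqs : set cauchy_seq := [set u | N (\val u n) @[n --> \oo] --> 0].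

Definition is_null_seq : pred cauchy_seq := fun u => u \in null_seqs.

Lemma is_null_seq_submod_closed : submod_closed is_null_seq.
Proof.
split.
  rewrite /in_mem/= /is_null_seq; apply/mem_set; rewrite /null_seqs /=.
  under eq_cvg do rewrite snorm0.
  exact: cvg_cst.
move=> a u v; rewrite /in_mem/= /is_null_seq => /set_mem cu /set_mem cv.
apply/mem_set; rewrite /null_seqs /=.
apply: (@squeeze_cvgr _ _ _ _ (cst 0) (fun n => `|a| * N (\val u n) + N (\val v n))).
- near=> n; rewrite snorm_ge0/=.
  by rewrite (le_trans (snormD _ _ _))// snormZ.
- exact: cvg_cst.
- rewrite -[X in _ --> X]addr0 -[X in _ --> X + _](mulr0 `|a|).
  by apply: cvgD => //; apply: cvgM => //; exact: cvg_cst.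
Unshelve. all: by end_near. Qed.

HB.instance Definition _ :=
  GRing.isSubmodClosed.Build R cauchy_seq is_null_seq is_null_seq_submod_closed.

Definition null_submod := GRing.ZmodClosed.clone cauchy_seq is_null_seq _.

Definition completion : Type := Quotient.quot null_submod.
HB.instance Definition _ := GRing.Zmodule.on completion.

Definition cclass (u : cauchy_seq) : completion := \pi_(Quotient.quot null_submod)%qT u.
Definition crepr (x : completion) : cauchy_seq :=
  @repr _ (Quotient.quot null_submod) x.

Lemma creprK : cancel crepr cclass.
Proof. exact: reprK. Qed.

Lemma cclass_eq u v : cclass u = cclass v <->
  N (\val u n - \val v n) @[n --> \oo] --> 0.
Proof.
suff : is_null_seq (u - v) <-> cclass u = cclass v.
  by move=> <-; rewrite /is_null_seq; split=> [/set_mem//|h]; exact/mem_set.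
have := Quotient.idealrBE null_submod u v.
by rewrite /in_mem/= => ->; split=> /eqP.
Qed.

Lemma cclassD u v : cclass (u + v) = cclass u + cclass v.
Proof. exact: (raddfD (\pi_(Quotient.quot null_submod)%qT)). Qed.

Lemma cclassB u v : cclass (u - v) = cclass u - cclass v.
Proof. exact: (raddfB (\pi_(Quotient.quot null_submod)%qT)). Qed.

Lemma cclass0 : cclass 0 = 0.
Proof. exact: (raddf0 (\pi_(Quotient.quot null_submod)%qT)). Qed.

Lemma crepr_cclass u : N (\val (crepr (cclass u)) n - \val u n) @[n --> \oo] --> 0.
Proof. by apply/cclass_eq; rewrite creprK. Qed.

Definition cscale (a : R) (x : completion) := cclass (a *: crepr x).

Lemma cclassZ a u : cclass (a *: u) = cscale a (cclass u).
Proof.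
apply/cclass_eq => /=.
have h : `|a| * N (\val (crepr (cclass u)) n - \val u n) @[n --> \oo] --> (0 : R).
  by rewrite -(mulr0 `|a|); apply: cvgM; [exact: cvg_cst|exact: crepr_cclass].
suff -> : (fun n => N (\val (a *: u) n - \val (a *: crepr (cclass u)) n)) =
  (fun n => `|a| * N (\val (crepr (cclass u)) n - \val u n)) by exact: h.
by apply/funext => n; rewrite (snormB (\val (crepr _) n)) -snormZ scalerBr.
Qed.

Lemma cscaleA a b x : cscale a (cscale b x) = cscale (a * b) x.
Proof. by rewrite -(creprK x) -!cclassZ scalerA. Qed.

Lemma cscale1 : left_id 1 cscale.
Proof. by move=> x; rewrite -(creprK x) -!cclassZ scale1r. Qed.

Lemma cscaleDr : right_distributive cscale +%R.
Proof.
move=> a x y.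
by rewrite -(creprK x) -(creprK y) -!cclassZ -!cclassD -!cclassZ scalerDr.
Qed.

Lemma cscaleDl x : {morph cscale^~ x : a b / a + b}.
Proof. by move=> a b; rewrite -(creprK x) -!cclassZ scalerDl cclassD. Qed.

HB.instance Definition _ := GRing.Zmodule_isLmodule.Build R completion
  cscaleA cscale1 cscaleDr cscaleDl.

Lemma cauchy_seqP (u : cauchy_seq) : cauchy_seqs (\val u).
Proof. by have := valP u; rewrite /is_cauchy_seq => /set_mem. Qed.

Lemma is_cvg_snorm (u : cauchy_seq) : cvgn (fun n => N (\val u n)).
Proof.
apply/cauchy_cvgP/cauchyP => e e0; have [M hM] := cauchy_seqP u e0.
exists (N (\val u M)); exists M => //= n Mn.
by apply: (le_lt_trans (snorm_dist _ _)); exact: hM.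
Qed.

Arguments is_cvg_snorm : clear implicits.

Definition cnorm (x : completion) : R := limn (fun n => N (\val (crepr x) n)).

Lemma cvg_cnorm u : N (\val u n) @[n --> \oo] --> cnorm (cclass u).
Proof.
set w := \val (crepr (cclass u)).
have -> : (fun n => N (\val u n)) =
    (fun n => N (w n)) - (fun n => N (w n) - N (\val u n)).
  by apply/funext => n; rewrite fctE subKr.
rewrite -(subr0 (cnorm _)); apply: cvgB; first exact: is_cvg_snorm.
apply/cvgr0Pnorm_lt => e e0.
have /cvgr0Pnorm_lt/(_ _ e0) := crepr_cclass u.
apply: filterS => n /=; rewrite (ger0_norm (snorm_ge0 _)).
exact: le_lt_trans (snorm_dist _ _).
Qed.

Arguments cvg_cnorm : clear implicits.

Lemma cnormE u : cnorm (cclass u) = limn (fun n => N (\val u n)).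
Proof. by apply/esym/cvg_lim => //; exact: cvg_cnorm. Qed.

Lemma ler_cnormD x y : cnorm (x + y) <= cnorm x + cnorm y.
Proof.
rewrite -(creprK x) -(creprK y) -cclassD.
have hx := cvg_cnorm (crepr x); have hy := cvg_cnorm (crepr y).
rewrite -(cvg_lim _ (cvgD hx hy))// -(cvg_lim _ (cvg_cnorm (_ + _)))//.
apply: ler_lim; [exact: is_cvg_snorm|exact: cvgP (cvgD hx hy)|].
by near=> n; rewrite /= snormD.
Unshelve. all: by end_near. Qed.

Lemma cnormZ a x : cnorm (a *: x) = `|a| * cnorm x.
Proof.
rewrite -(creprK x) -[_ *: _]cclassZ -(cvg_lim _ (cvg_cnorm (_ *: _)))//.
apply: cvg_lim => //=; under eq_cvg do rewrite snormZ.
by apply: cvgM; [exact: cvg_cst|exact: cvg_cnorm].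
Qed.

Lemma cnorm0_eq0 x : cnorm x = 0 -> x = 0.
Proof.
rewrite -(creprK x) => h; rewrite -cclass0; apply/cclass_eq; rewrite -h.
suff -> : (fun n => N (\val (crepr x) n - \val (0 : cauchy_seq) n)) =
  (fun n => N (\val (crepr x) n)) by exact: cvg_cnorm.
by apply/funext => n; rewrite subr0.
Qed.

HB.instance Definition _ := Lmodule_isNormed.Build R completion
  ler_cnormD cnormZ cnorm0_eq0.

Lemma cnorm_cclass u : N (\val u n) @[n --> \oo] --> `|cclass u|.
Proof. exact: cvg_cnorm. Qed.

Arguments cnorm_cclass : clear implicits.

Lemma const_cauchy v : is_cauchy_seq (fun=> v).
Proof.
rewrite /is_cauchy_seq; apply/mem_set => e e0; exists 0%N => n k _ _.
by rewrite subrr snorm0.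
Qed.

Definition cembed (v : V) : completion := cclass (Sub (fun=> v) (const_cauchy v)).

Lemma cembed_norm v : `|cembed v| = N v.
Proof.
have /cvg_lim <-// := cnorm_cclass (Sub (fun=> v) (const_cauchy v)).
by rewrite SubK lim_cst.
Qed.

Lemma cembed_linear : linear cembed.
Proof.
move=> a u v; rewrite /cembed -[a *: cclass _]cclassZ -cclassD; congr cclass.
by apply: val_inj.
Qed.

HB.instance Definition _ := GRing.isLinear.Build R V completion _ cembed
  cembed_linear.

Lemma cembed_approx (u : cauchy_seq) (e : R) : 0 < e ->
  exists M, forall n, (M <= n)%N -> `|cclass u - cembed (\val u n)| <= e.
Proof.
move=> e0; have [M hM] := cauchy_seqP u e0; exists M => n Mn.
have -> : cclass u - cembed (\val u n) =
    cclass (u - Sub (fun=> \val u n) (const_cauchy (\val u n))).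
  by rewrite cclassB.
have h := cnorm_cclass (u - Sub (fun=> \val u n) (const_cauchy (\val u n))).
apply: (cvgr_to_le h); exists M => //= k Mk.
by rewrite ltW// hM.
Qed.

Lemma cembed_dense (x : completion) (e : R) : 0 < e ->
  exists v, `|x - cembed v| < e.
Proof.
move=> e0; have e20 : 0 < e / 2 by rewrite divr_gt0.
have [M /(_ M (leqnn _))] := cembed_approx (crepr x) e20.
rewrite creprK => h; exists (\val (crepr x) M).
by rewrite (le_lt_trans h)// ltr_pdivrMr// ltr_pMr// ltr1n.
Qed.

Lemma completion_cauchy_cvg (F : set_system completion) :
  ProperFilter F -> cauchy F -> cvg F.
Proof.
move=> FF /cauchyP cF.
have /choice[v Fv] : forall n : nat, exists v,
    F (ball (cembed v) (n.+1%:R^-1 : R)).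
  move=> n; have e0 : 0 < (n.+1%:R^-1 : R) / 2 by rewrite divr_gt0.
  have [x Fx] := cF _ e0; have [v xv] := cembed_dense x e0.
  exists v; apply: filterS Fx => y xy.
  by apply: (ball_splitr _ xy); rewrite -ball_normE.
have Nv n k : N (v n - v k) < n.+1%:R^-1 + k.+1%:R^-1.
  have [y [yn yk]] := filter_ex (filterI (Fv n) (Fv k)).
  have := ball_triangle yn (ball_sym yk).
  by rewrite -ball_normE /ball_/= -raddfB cembed_norm.
have small (e : R) : 0 < e ->
    exists M, forall n, (M <= n)%N -> (n.+1%:R^-1 : R) < e / 2.
  move=> e0; have e20 : 0 < e / 2 by rewrite divr_gt0.
  by have [M _ hM] := near_infty_natSinv_lt (PosNum e20); exists M.
have cv : is_cauchy_seq v.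
  rewrite /is_cauchy_seq; apply/mem_set => e e0.
  have [M hM] := small e e0; exists M => n k Mn Mk.
  by rewrite (lt_trans (Nv n k))// (splitr e) ltrD// hM.
apply/cvg_ex; exists (cclass (Sub v cv)); apply/cvg_ballP => e e0.
have e20 : 0 < e / 2 by rewrite divr_gt0.
have e40 : 0 < e / 2 / 2 by rewrite divr_gt0.
have [M1 hM1] := small e e0.
have [M2 hM2] := cembed_approx (Sub v cv : cauchy_seq) e40.
have := Fv (maxn M1 M2); apply: filterS => y /(le_ball (ltW (hM1 _ (leq_maxl _ _)))).
move=> /(ball_triangle _); rewrite [e in ball _ e _]splitr; apply.
rewrite -ball_normE /ball_/= (le_lt_trans (hM2 _ (leq_maxr M1 _)))//.
by rewrite ltr_pdivrMr// ltr_pMr// ltr1n.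
Qed.

HB.instance Definition _ := Uniform_isComplete.Build completion
  completion_cauchy_cvg.

End Completion.

(* The seminorm given by the infimum of the costs c allowed for u by P. *)
Section Gauge.
Variables (R : realType) (V : lmodType R) (P : V -> set R).
Hypothesis P_ge0 : forall u c, P u c -> 0 <= c.
Hypothesis P_ex : forall u, P u !=set0.
Hypothesis P_add : forall u v c d, P u c -> P v d -> P (u + v) (c + d).
Hypothesis P_scale : forall a u c, P u c -> P (a *: u) (`|a| * c).

Lemma gauge_has_inf u : has_inf (P u).
Proof. by split; [exact: P_ex|exists 0 => c /P_ge0]. Qed.

Lemma gaugeD u v : inf (P (u + v)) <= inf (P u) + inf (P v).
Proof.
apply/ler_addgt0Pr => e e0; have e20 : 0 < e / 2 by rewrite divr_gt0.
have [c Pc ce] := inf_adherent e20 (gauge_has_inf u).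
have [d Pd de] := inf_adherent e20 (gauge_has_inf v).
rewrite (le_trans (ge_inf (gauge_has_inf _).2 (P_add Pc Pd)))//.
by rewrite (le_trans (ltW (ltrD ce de)))// addrACA -splitr.
Qed.

Lemma gaugeZ_le a u : inf (P (a *: u)) <= `|a| * inf (P u).
Proof.
apply/ler_addgt0Pr => e e0.
have a1 : 0 < `|a| + 1 by rewrite ltr_wpDl.
have [c Pc ce] := inf_adherent (divr_gt0 e0 a1) (gauge_has_inf u).
rewrite (le_trans (ge_inf (gauge_has_inf _).2 (P_scale a Pc)))//.
rewrite (le_trans (ler_wpM2l _ (ltW ce)))// mulrDr lerD2l.
by rewrite mulrCA ler_piMr ?ltW// ltr_pdivrMr// mul1r ltrDl.
Qed.

Lemma gaugeZ a u : inf (P (a *: u)) = `|a| * inf (P u).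
Proof.
have ge0 v : 0 <= inf (P v) by apply: lb_le_inf => // c /P_ge0.
apply/eqP; rewrite eq_le gaugeZ_le/=.
have [->|a0] := eqVneq a 0; first by rewrite normr0 mul0r.
have := gaugeZ_le a^-1 (a *: u); rewrite scalerA mulVf// scale1r.
by rewrite normfV ler_pdivlMl// normr_gt0.
Qed.

Definition gauge : seminorm V := Seminorm gaugeD gaugeZ.

End Gauge.

Section Multilinear.
Variables (R : realType) (m : nat) (X : 'I_m -> completeNormedModType R).

Definition multilinear (W : lmodType R) (f : (forall j, X j) -> W) :=
  forall (x : forall j, X j) (j : 'I_m) (a : R) (u v : X j),
    f (dfwith x j (a *: u + v)) = a *: f (dfwith x j u) + f (dfwith x j v).

Definition continuous_multilinear (W : normedModType R)
    (f : (forall j, X j) -> W) :=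
  multilinear f /\ continuous (f : prod_topology (fun j => X j) -> W).

Definition form_norm (phi : (forall j, X j) -> R) : \bar R :=
  ereal_sup [set `|phi x|%:E | x in [set x | forall j, `|x j| <= 1]].

Definition form_ball : set ((forall j, X j) -> R) :=
  [set phi | continuous_multilinear phi /\ (form_norm phi <= 1)%E].

(* the closed unit ball of the space of continuous m-linear forms *)
Definition mball : Type := {phi : (forall j, X j) -> R | phi \in form_ball}.
HB.instance Definition _ := SubChoice.on mball.

Definition mball_val (phi : mball) : (forall j, X j) -> R := \val phi.
Coercion mball_val : mball >-> Funclass.

Lemma form_ball0 : (fun _ : forall j, X j => 0 : R) \in form_ball.
Proof.
apply/mem_set; split; [split|].
- by move=> x j a u v /=; rewrite scaler0 addr0.
- exact: cst_continuous.
- by apply: ge_ereal_sup => _ [x _ <-]; rewrite normr0 lee_fin.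
Qed.

HB.instance Definition _ := isPointed.Build mball (Sub (fun=> 0) form_ball0 : mball).

(* elem x is <x^1 ⊗ ... ⊗ x^m, .>.  The linear span Vm of these functions is
   the model of the algebraic tensor product of the X j: two formal sums of
   elementary tensors are identified when they agree on mball. *)
Definition elem (x : forall j, X j) : mball -> R := fun phi => phi x.

Definition elem_span : set (mball -> R) := [set f |
  exists n (lam : 'I_n -> R) (x : 'I_n -> forall j, X j),
    f = \sum_(k < n) lam k *: elem (x k)].

Definition in_elem_span : pred (mball -> R) := fun f => f \in elem_span.

Lemma elem_span_submod_closed : submod_closed in_elem_span.
Proof.
split.
  apply/mem_set; exists 0%N, (fun=> 0), (fun _ _ => 0).
  by rewrite big_ord0.
move=> a f g /set_mem[n [lam [x ->]]] /set_mem[k [mu [y ->]]].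
apply/mem_set; exists (n + k)%N.
exists (fun i => match fintype.split i with inl i => a * lam i | inr i => mu i end).
exists (fun i => match fintype.split i with inl i => x i | inr i => y i end).
rewrite big_split_ord scaler_sumr; congr (_ + _); apply: eq_bigr => i _.
  by rewrite -[lshift _ _]/(unsplit (inl _)) unsplitK scalerA.
by rewrite -[rshift _ _]/(unsplit (inr _)) unsplitK.
Qed.

HB.instance Definition _ :=
  GRing.isSubmodClosed.Build R (mball -> R) in_elem_span elem_span_submod_closed.

Definition Vm := {f : mball -> R | in_elem_span f}.
HB.instance Definition _ := SubChoice.on Vm.
HB.instance Definition _ := [SubChoice_isSubLmodule of Vm by <:].

Lemma elem_in_span x : in_elem_span (elem x).
Proof.
apply/mem_set; exists 1%N, (fun=> 1), (fun=> x).
by rewrite big_ord1 scale1r.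
Qed.

(* x |-> <x^1 ⊗ ... ⊗ x^m, .>, with values in Vm *)
Definition imap (x : forall j, X j) : Vm := Sub (elem x) (elem_in_span x).

Lemma VmP (v : Vm) : exists n (lam : 'I_n -> R) (x : 'I_n -> forall j, X j),
  v = \sum_(k < n) lam k *: imap (x k).
Proof.
have /set_mem[n [lam [x vE]]] := valP v; exists n, lam, x.
by apply: val_inj; rewrite vE raddf_sum.
Qed.

Definition proj_cost (v : Vm) : set R := [set c |
  exists n (lam : 'I_n -> R) (x : 'I_n -> forall j, X j),
    v = \sum_(k < n) lam k *: imap (x k) /\
    c = \sum_(k < n) `|lam k| * \prod_(j < m) `|x k j|].

Lemma proj_cost_ge0 v c : proj_cost v c -> 0 <= c.
Proof.
by move=> [n [lam [x [_ ->]]]]; apply: sumr_ge0 => k _; rewrite mulr_ge0 ?prodr_ge0.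
Qed.

Lemma proj_cost_ex v : proj_cost v !=set0.
Proof.
have [n [lam [x vE]]] := VmP v.
by exists (\sum_(k < n) `|lam k| * \prod_(j < m) `|x k j|), n, lam, x.
Qed.

Lemma proj_costD u v c d :
  proj_cost u c -> proj_cost v d -> proj_cost (u + v) (c + d).
Proof.
move=> [n [lam [x [-> ->]]]] [k [mu [y [-> ->]]]].
exists (n + k)%N.
exists (fun i => match fintype.split i with inl i => lam i | inr i => mu i end).
exists (fun i => match fintype.split i with inl i => x i | inr i => y i end).
rewrite !big_split_ord; split; congr (_ + _); apply: eq_bigr => i _;
by rewrite -?[lshift _ _]/(unsplit (inl _)) -?[rshift _ _]/(unsplit (inr _)) unsplitK.
Qed.

Lemma proj_costZ a u c : proj_cost u c -> proj_cost (a *: u) (`|a| * c).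
Proof.
move=> [n [lam [x [-> ->]]]]; exists n, (fun k => a * lam k), x; split.
  by rewrite scaler_sumr; apply: eq_bigr => k _; rewrite scalerA.
by rewrite mulr_sumr; apply: eq_bigr => k _; rewrite normrM mulrA.
Qed.

(* the projective tensor norm *)
Definition proj_norm : seminorm Vm :=
  gauge proj_cost_ge0 proj_cost_ex proj_costD proj_costZ.

(* the (completed) projective tensor product of the X j *)
Definition ptensor := completion proj_norm.

(* value at u of the functional on ptensor corresponding to phi: the extension
   of v |-> v phi from Vm by continuity, see pairing_cembed *)
Definition pairing (phi : mball) (u : ptensor) : R :=
  limn (fun n => \val (\val (crepr u) n) phi).

(* mball with the weak* topology: pointwise convergence on ptensor *)
Definition wball := initial_topology (pairing : mball -> {ptws ptensor -> R}).


Lemma multilinear_scale (W : lmodType R) (f : (forall j, X j) -> W) x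
  (c : 'I_m -> R) : multilinear f ->
  f (fun j => c j *: x j) = (\prod_(j < m) c j) *: f x.
Proof.
move=> fL.
have f0 y j : f (dfwith y j 0) = 0.
  have := fL y j 1 0 0; rewrite scaler0 addr0 scale1r => /esym/eqP.
  by rewrite -subr_eq0 addrK => /eqP.
have fZ y j a u : f (dfwith y j (a *: u)) = a *: f (dfwith y j u).
  by have := fL y j a u 0; rewrite f0 !addr0.
suff H (s : seq 'I_m) : uniq s ->
    f (fun j => if j \in s then c j *: x j else x j) = (\prod_(j <- s) c j) *: f x.
  rewrite -big_enum -H ?enum_uniq//; congr f.
  by apply: functional_extensionality_dep => j; rewrite mem_enum.
elim: s => [_|i s ih /= /andP[iNs us]].
  by rewrite big_nil scale1r.
rewrite big_cons -scalerA -ih//.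
set y := fun j => if j \in s then c j *: x j else x j.
have -> : (fun j => if j \in i :: s then c j *: x j else x j) =
    dfwith y i (c i *: x i).
  apply: functional_extensionality_dep => j; rewrite inE.
  case: dfwithP => [|j' ij']; first by rewrite eqxx.
  by rewrite eq_sym (negbTE ij').
rewrite fZ; congr (_ *: f _).
apply: functional_extensionality_dep => j.
by case: dfwithP => [|//]; rewrite /y (negbTE iNs).
Qed.

Lemma mball_multilinear (phi : mball) : multilinear (W := R) phi.
Proof. by have /set_mem[[]] := valP phi. Qed.

Lemma mball_le (phi : mball) x : `|phi x| <= \prod_(j < m) `|x j|.
Proof.
have /set_mem[_ phi1] := valP phi.
have -> : phi x = \prod_(j < m) `|x j| * phi (fun j => `|x j|^-1 *: x j).
  rewrite -[RHS](multilinear_scale _ _ (mball_multilinear phi)); congr (phi _).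
  apply: functional_extensionality_dep => j.
  have [->|xj0] := eqVneq (x j) 0; first by rewrite !scaler0.
  by rewrite scalerA divff ?normr_eq0// scale1r.
rewrite normrM ger0_norm ?prodr_ge0// ler_piMr ?prodr_ge0//.
rewrite -lee_fin (le_trans _ phi1)//; apply: ereal_sup_ubound.
exists (fun j => `|x j|^-1 *: x j) => // j.
rewrite normrZ normfV normr_id.
have [->|xj0] := eqVneq (x j) 0; first by rewrite normr0 mulr0.
by rewrite mulVf// normr_eq0.
Qed.

Lemma Vm_le (v : Vm) (phi : mball) : `|\val v phi| <= proj_norm v.
Proof.
apply: lb_le_inf; first exact: proj_cost_ex.
move=> c [n [lam [x [-> ->]]]].
rewrite raddf_sum fct_sumE (le_trans (ler_norm_sum _ _ _))//.
apply: ler_sum => k _; rewrite normrM ler_wpM2l//; exact: mball_le.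
Qed.

Lemma pairing_cembed (phi : mball) (v : Vm) :
  pairing phi (cembed proj_norm v) = \val v phi.
Proof.
apply: cvg_lim => //; apply/cvgrPdist_lt => e e0.
have /cvgr0Pnorm_lt/(_ _ e0) := crepr_cclass
  (Sub (fun=> v) (const_cauchy proj_norm v) : cauchy_seq proj_norm).
apply: filterS => n; rewrite ger0_norm ?snorm_ge0//.
by apply: le_lt_trans; rewrite distrC; exact: (Vm_le (_ - v)).
Qed.

Lemma elem_continuous x : continuous (elem x : wball -> R).
Proof.
have -> : elem x = (fun phi => pairing phi (cembed proj_norm (imap x))).
  by apply/funext => phi; rewrite pairing_cembed.
move=> phi.
apply: (@continuous_comp _ _ _ (pairing : wball -> {ptws ptensor -> R})
  (fun f => f (cembed proj_norm (imap x)))).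
  exact: initial_continuous.
exact: (@proj_continuous _ (fun _ : ptensor => R) (cembed proj_norm (imap x))).
Qed.

Definition borel_wball := g_sigma_algebraType (@open wball).

Lemma measurable_elem x : measurable_fun setT (elem x : borel_wball -> R).
Proof.
apply: (measurability _ (RGenOpens.measurableE R)).
move=> _ [_ [a [b ->] <-]]; rewrite setTI; apply: sub_sigma_algebra.
by have /continuousP := @elem_continuous x; apply; exact: interval_open.
Qed.

Section Domination.
Variables p sigma : R.

(* sum_k |lam^k| |phi(x^{1,k},...,x^{m,k})|^(1 - sigma) prod_j ||x^{j,k}||^sigma;
   as powR 0 0 = 1, the last factor is 1 when sigma = 0 *)
Definition weight n (lam : 'I_n -> R) (x : 'I_n -> forall j, X j)
    (phi : mball) : R :=
  \sum_(k < n) `|lam k| * `|phi (x k)| `^ (1 - sigma) *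
    \prod_(j < m) `|x k j| `^ sigma.

Definition weight_norm (eta : probability borel_wball R)
    n (lam : 'I_n -> R) (x : 'I_n -> forall j, X j) : R :=
  (\int[eta]_(phi in setT) `|weight lam x phi| `^ (p / (1 - sigma)))
    `^ ((1 - sigma) / p).

Definition dom_cost (eta : probability borel_wball R) (v : Vm) : set R := [set c |
  exists r s (lam : 'I_r -> 'I_s -> R) (x : 'I_r -> 'I_s -> forall j, X j),
    v = \sum_(i < r) \sum_(k < s) lam i k *: imap (x i k) /\
    c = \sum_(i < r) weight_norm eta (lam i) (x i)].

Lemma measurable_weight n (lam : 'I_n -> R) x :
  measurable_fun setT (weight lam x : borel_wball -> R).
Proof.
apply: measurable_sum => k; apply: measurable_funM => //.
apply: measurable_funM => //.
apply: (measurableT_comp (measurable_powR _)).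
apply: (measurableT_comp (@normr_measurable R setT)).
exact: measurable_elem.
Qed.

Variable eta : probability borel_wball R.

Lemma dom_cost_ge0 v c : dom_cost eta v c -> 0 <= c.
Proof. by move=> [r [s [lam [x [_ ->]]]]]; apply: sumr_ge0 => *; exact: powR_ge0. Qed.

Lemma dom_cost_ex v : dom_cost eta v !=set0.
Proof.
have [n [lam [x vE]]] := VmP v.
exists (\sum_(i < 1) weight_norm eta lam x), 1%N, n, (fun=> lam), (fun=> x).
by rewrite big_ord1.
Qed.

Lemma eq_weight_norm n n' (lam : 'I_n -> R) x (mu : 'I_n' -> R) y :
  weight lam x =1 weight mu y -> weight_norm eta lam x = weight_norm eta mu y.
Proof. by move=> /funext h; rewrite /weight_norm h. Qed.

Lemma dom_costD u v c d :
  dom_cost eta u c -> dom_cost eta v d -> dom_cost eta (u + v) (c + d).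
Proof.
move=> [r1 [s1 [lam [x [-> ->]]]]] [r2 [s2 [mu [y [-> ->]]]]].
exists (r1 + r2)%N, (s1 + s2)%N.
exists (fun i k => match fintype.split i, fintype.split k with
  | inl i, inl k => lam i k | inr i, inr k => mu i k | _, _ => 0 end).
exists (fun i k => match fintype.split i, fintype.split k with
  | inl i, inl k => x i k | inr i, inr k => y i k | _, _ => fun=> 0 end).
have splitl n1 n2 (i : 'I_n1) : fintype.split (lshift n2 i) = inl i.
  by rewrite -[lshift _ _]/(unsplit (inl _)) unsplitK.
have splitr n1 n2 (i : 'I_n2) : fintype.split (rshift n1 i) = inr i.
  by rewrite -[rshift _ _]/(unsplit (inr _)) unsplitK.
split.
  rewrite big_split_ord /=; congr (_ + _); apply: eq_bigr => i _.
    rewrite big_split_ord /= [X in _ = _ + X]big1 ?addr0 => [|k _]; last first.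
      by rewrite splitl splitr scale0r.
    by apply: eq_bigr => k _; rewrite !splitl.
  rewrite big_split_ord /= [X in _ = X + _]big1 ?add0r => [|k _]; last first.
    by rewrite splitl splitr scale0r.
  by apply: eq_bigr => k _; rewrite !splitr.
rewrite [RHS]big_split_ord; apply: (congr2 +%R); apply: eq_bigr => i _.
  apply: eq_weight_norm => phi.
  rewrite /weight big_split_ord /= [X in _ = _ + X]big1 ?addr0 => [|k _]; last first.
    by rewrite splitl splitr normr0 !mul0r.
  by apply: eq_bigr => k _; rewrite !splitl.
apply: eq_weight_norm => phi.
rewrite /weight big_split_ord /= [X in _ = X + _]big1 ?add0r => [|k _]; last first.
  by rewrite splitl splitr normr0 !mul0r.
by apply: eq_bigr => k _; rewrite !splitr.
Qed.

Hypotheses (p1 : 1 <= p) (sigma1 : sigma < 1).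

Lemma weight_normZ a n (lam : 'I_n -> R) x :
  weight_norm eta (fun k => a * lam k) x = `|a| * weight_norm eta lam x.
Proof.
have p0 : p != 0 by rewrite gt_eqF// (lt_le_trans ltr01).
have s0 : 1 - sigma != 0 by rewrite subr_eq0 gt_eqF.
rewrite /weight_norm.
rewrite (_ : Rintegral _ _ _ = `|a| `^ (p / (1 - sigma)) *
    \int[eta]_(phi in setT) `|weight lam x phi| `^ (p / (1 - sigma))); last first.
  rewrite /Rintegral; under eq_integral => phi _.
    rewrite (_ : weight _ _ _ = `|a| * weight lam x phi); last first.
      by rewrite /weight mulr_sumr; apply: eq_bigr => k _; rewrite normrM !mulrA.
    rewrite normrM normr_id powRM// EFinM.
    over.
  rewrite ge0_integralZl//=.
  - set I := (\int[_]_(_ in _) _)%E.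
    have : (0 <= I)%E by apply: integral_ge0 => phi _; rewrite lee_fin powR_ge0.
    case: I => [r _||] //=.
    have [->|a0 _] := eqVneq (`|a| `^ (p / (1 - sigma))) 0.
      by rewrite mul0e mul0r.
    by rewrite gt0_muley ?lte_fin ?lt_def ?a0 ?powR_ge0//= mulr0.
  - apply/measurable_EFinP; apply: (measurableT_comp (measurable_powR _)).
    apply: (measurableT_comp (@normr_measurable R setT)).
    exact: measurable_weight.
rewrite powRM ?powR_ge0//; last first.
  by apply: fine_ge0; apply: integral_ge0 => phi _; rewrite lee_fin powR_ge0.
by rewrite -powRrM mulrA divfK// divff// powRr1.
Qed.

Lemma dom_costZ a u c : dom_cost eta u c -> dom_cost eta (a *: u) (`|a| * c).
Proof.
move=> [r [s [lam [x [-> ->]]]]].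
exists r, s, (fun i k => a * lam i k), x; split.
  rewrite scaler_sumr; apply: eq_bigr => i _.
  by rewrite scaler_sumr; apply: eq_bigr => k _; rewrite scalerA.
by rewrite mulr_sumr; apply: eq_bigr => i _; rewrite weight_normZ.
Qed.

Definition dom_norm : seminorm Vm :=
  gauge dom_cost_ge0 dom_cost_ex dom_costD dom_costZ.

(* the domination space L_{p,sigma}(eta) *)
Definition Lpsigma := completion dom_norm.

Definition ipsigma : Vm -> Lpsigma := cembed dom_norm.

End Domination.

Definition strongly_factorable p sigma (Y : normedModType R)
    (T : (forall j, X j) -> Y) :=
  exists2 C : R, 0 < C & forall n1 n2 (lam : 'I_n1 -> 'I_n2 -> R)
    (x : 'I_n1 -> 'I_n2 -> forall j, X j),
    (\sum_(i < n1) `|\sum_(k < n2) lam i k *: T (x i k)| `^ (p / (1 - sigma)))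
      `^ ((1 - sigma) / p)
    <= C * sup [set (\sum_(i < n1)
                      `|weight sigma (lam i) (x i) phi| `^ (p / (1 - sigma)))
                    `^ ((1 - sigma) / p) | phi in [set: mball]].

End Multilinear.

Definition regular_measure (R : realType) (T : ptopologicalType)
    (mu : {measure set (g_sigma_algebraType (@open T)) -> \bar R}) :=
  forall A : set T, (@open T).-sigma.-measurable A ->
    mu A = ereal_inf [set mu U | U in [set U : set T | open U /\ A `<=` U]] /\
    mu A = ereal_sup [set mu K | K in [set K : set T | compact K /\ K `<=` A]].

(* Main.v *)
(* (1) => (2) is Pietsch's domination argument.  With q = p / (1 - sigma), (1)
   says that no finite sum of the functions
   C^q |weight|^q - |sum_k lam^k T (x^k)|^q is bounded above by a negative number
   on the ball.  By Hahn-Banach there is a linear functional L <= sup on the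
   bounded functions that is nonnegative on all of them.  The ball is weak*
   compact and Hausdorff, so the finitely additive A |-> L 1_A induces a regular
   Borel probability eta with L 1_F <= eta F for F closed, and summing over the
   levels of f gives L f <= int f d(eta) for f >= 0 continuous.
   (2) => (3): T extends linearly to V_m since the dual of Y separates points;
   (2) bounds the extension by the seminorm, so it passes to the completion.
   (3) => (1): bound the seminorm by the cost of a one-block representation and
   integrate, eta having total mass 1. *)
Require Import Defs.
From HB Require Import structures.
From mathcomp Require Import all_boot all_order all_algebra.
From mathcomp Require Import all_classical all_reals all_analysis.
From mathcomp Require Import finmap ring lra measurable_realfun.

Set Implicit Arguments.
Unset Strict Implicit.
Unset Printing Implicit Defensive.

Import Order.TTheory GRing.Theory Num.Theory.
Import numFieldNormedType.Exports.

Local Open Scope classical_set_scope.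
Local Open Scope ring_scope.

(** * Sublinear functionals and the Hahn-Banach theorem *)

Section HahnBanach.
Variables (R : realType) (V : lmodType R).

Definition sublinear (s : V -> R) :=
  (forall u v, s (u + v) <= s u + s v) /\
  (forall a v, 0 <= a -> s (a *: v) = a * s v).

Lemma sublinear_ge (s : V -> R) v : sublinear s -> - s (- v) <= s v.
Proof.
move=> [sD sZ]; have := sD v (- v).
by rewrite subrr -(scale0r 0) sZ// mul0r addrC -lerBlDl sub0r.
Qed.

(** All sublinear functionals constructed below are infima of this form. The witness may undercut
    [c + d] because over a chain of functionals the smaller of two has to be chosen. Homogeneity
    follows from one inequality, applied to [a] and to [a^-1]. *)
Lemma sublinear_inf (P : V -> set R) :
  (forall v, P v !=set0) -> (forall v, has_lbound (P v)) ->
  (forall u v c d, P u c -> P v d -> exists2 e, P (u + v) e & e <= c + d) ->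
  (forall a v c, 0 < a -> P v c -> exists2 e, P (a *: v) e & e <= a * c) ->
  sublinear (fun v => inf (P v)).
Proof.
move=> P0 Pl PD PZ.
have hi v : has_inf (P v) by [].
have sD u v : inf (P (u + v)) <= inf (P u) + inf (P v).
  apply/ler_addgt0Pr => e e0; have e20 : 0 < e / 2 by rewrite divr_gt0.
  have [c Pc ce] := inf_adherent e20 (hi u).
  have [d Pd de] := inf_adherent e20 (hi v).
  have [b Pb bcd] := PD _ _ _ _ Pc Pd.
  rewrite (le_trans (ge_inf (Pl _) Pb))// (le_trans bcd)//.
  by rewrite (le_trans (ltW (ltrD ce de)))// addrACA -splitr.
have Z_le a v : 0 < a -> inf (P (a *: v)) <= a * inf (P v).
  move=> a0; rewrite mulrC -ler_pdivrMr//; apply: lb_le_inf => // c Pc.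
  have [e Pe ec] := PZ _ _ _ a0 Pc.
  by rewrite ler_pdivrMr// mulrC (le_trans (ge_inf (Pl _) Pe)).
split=> // a v; rewrite le_eqVlt => /predU1P[<-|a0].
  (* At [a = 0]: [inf (P 0)] is at most its double and at most its half, hence 0. *)
  have ge1 : inf (P 0) <= 2 * inf (P 0) by rewrite -{1}(scaler0 _ 2) Z_le.
  have ge2 : inf (P 0) <= 2^-1 * inf (P 0).
    by rewrite -{1}(scaler0 _ 2^-1) Z_le// invr_gt0.
  rewrite scale0r mul0r; apply/eqP; rewrite eq_le; apply/andP; split; lra.
apply/eqP; rewrite eq_le Z_le//=.
have := @Z_le a^-1 (a *: v); rewrite invr_gt0 => /(_ a0).
by rewrite scalerA mulVf ?gt_eqF// scale1r ler_pdivlMl.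
Qed.

(* A pointwise minimal sublinear functional [q <= s] is linear: minimality applied
   to [x |-> inf_t q (x + t v) - t q v] gives [q u + q v <= q (u + v)]. *)
Lemma hahn_banach (s : V -> R) : sublinear s ->
  exists L : {scalar V}, forall v, L v <= s v.
Proof.
move=> ss.
pose T := {q : V -> R | sublinear q /\ forall v, q v <= s v}.
pose mk q sq qs : T := exist _ q (conj sq qs).
(* The order is reversed, so that the maximal element given by Zorn is a minimal functional. *)
pose geF (q r : T) := `[< forall v, sval r v <= sval q v >].
have geF_refl q : geF q q by apply/asboolP.
have geF_trans q r t : geF q r -> geF r t -> geF q t.
  by move=> /asboolP qr /asboolP rt; apply/asboolP => v; rewrite (le_trans (rt v)).
have geF_anti q r : geF q r -> geF r q -> q = r.
  move=> /asboolP qr /asboolP rq; apply: eq_sig_hprop.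
    by move=> ?; exact: Prop_irrelevance.
  by apply/funext => v; apply/eqP; rewrite eq_le qr rq.
(* A lower bound independent of [q] keeps the infimum over a chain finite. *)
have lb (q : T) v : - s (- v) <= sval q v.
  case: q => q [sq qs] /=; rewrite (le_trans _ (sublinear_ge v sq))//.
  by rewrite lerN2 qs.
have [A totA|[q [sq qs]] minq] := Zorn geF_refl geF_trans geF_anti.
  have [A0|A0] := pselect (A = set0).
    by exists (mk _ ss (fun v => lexx _)) => q; rewrite A0.
  have /set0P[q0 Aq0] : A != set0 by exact/eqP.
  pose P v := [set sval q v | q in A].
  have PI : sublinear (fun v => inf (P v)).
    apply: sublinear_inf.
    - by move=> v; exists (sval q0 v), q0.
    - by move=> v; exists (- s (- v)) => _ [q Aq <-].
    - move=> u v _ _ [q Aq <-] [r Ar <-].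
      have [/asboolP qr|/asboolP qr] := totA _ _ Aq Ar.
        exists (sval r (u + v)); first by exists r.
        by rewrite (le_trans ((svalP r).1.1 _ _))// lerD2r.
      exists (sval q (u + v)); first by exists q.
      by rewrite (le_trans ((svalP q).1.1 _ _))// lerD2l.
    - move=> a v _ a0 [q Aq <-]; exists (sval q (a *: v)); first by exists q.
      by rewrite (svalP q).1.2// ltW.
  have Pq v q : A q -> inf (P v) <= sval q v.
    by move=> Aq; apply: ge_inf; [exists (- s (- v)) => _ [r _ <-]|exists q].
  have Is v : inf (P v) <= s v by rewrite (le_trans (Pq v _ Aq0))// (svalP q0).2.
  exists (mk _ PI Is) => q Aq; apply/asboolP => v; exact: Pq.
have qD u v : q (u + v) = q u + q v.
  apply/eqP; rewrite eq_le sq.1/=.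
  pose P x := [set q (x + t *: v) - t * q v | t in [set t | 0 <= t]].
  have lP x : lbound (P x) (- q (- x)).
    move=> _ [t /= t0 <-]; rewrite lerBrDl -sq.2// lerBlDl.
    by rewrite -{1}(addKr x (t *: v)) (le_trans (sq.1 _ _))// addrC.
  have PI : sublinear (fun x => inf (P x)).
    apply: sublinear_inf.
    - by move=> x; exists (q (x + 0 *: v) - 0 * q v), 0 => /=.
    - by move=> x; exists (- q (- x)).
    - move=> x y _ _ [t /= t0 <-] [t' /= t'0 <-].
      exists (q (x + y + (t + t') *: v) - (t + t') * q v).
        by exists (t + t') => //=; rewrite addr_ge0.
      by rewrite scalerDl addrACA mulrDl opprD [leRHS]addrACA lerD2r sq.1.
    - move=> a x _ a0 [t /= t0 <-]; exists (q (a *: x + (a * t) *: v) - (a * t) * q v).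
        by exists (a * t) => //=; rewrite mulr_ge0// ltW.
      by rewrite -scalerA -scalerDr sq.2 ?(ltW a0)// -mulrA mulrBr.
  have Pq x t : 0 <= t -> inf (P x) <= q (x + t *: v) - t * q v.
    by move=> t0; apply: ge_inf; [exists (- q (- x))|exists t].
  have Pq0 x : inf (P x) <= q x by have := Pq x 0 (lexx _); rewrite scale0r addr0 mul0r subr0.
  have Ps x : inf (P x) <= s x by rewrite (le_trans (Pq0 x)).
  rewrite -[q u](congr1 (fun r : T => sval r u) (minq (mk _ PI Ps) (asboolT Pq0))) /=.
  by have := Pq u 1 ler01; rewrite scale1r mul1r lerBrDr.
have qN v : q (- v) = - q v.
  apply/eqP; rewrite -addr_eq0 addrC -qD subrr -(scale0r 0) sq.2// mul0r.
  exact: eqxx.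
have qZ a u : q (a *: u) = a * q u.
  have [a0|a0] := leP 0 a; first exact: sq.2.
  by rewrite -[a in LHS]opprK scaleNr qN sq.2 ?oppr_ge0 ?ltW// mulNr opprK.
have q_scalar : scalar q by move=> a u v /=; rewrite qD qZ.
pose qL := GRing.isLinear.Build R V R *%R q q_scalar.
pose L : {scalar V} := HB.pack q qL.
by exists L.
Qed.

End HahnBanach.

(** * From a finitely additive set function to a regular Borel probability *)

Section RegularExtension.
Local Open Scope ereal_scope.
Variables (R : realType) (K : ptopologicalType).
Hypotheses (hK : hausdorff_space K) (cK : compact [set: K]).
Variable c : set K -> R.
Hypothesis c_ge0 : forall A, (0 <= c A)%R.
Hypothesis cU : forall A B, A `&` B = set0 -> c (A `|` B) = (c A + c B)%R.
Hypothesis cT : c setT = 1%R.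

Let c0 : c set0 = 0%R.
Proof.
by have := cU (setI0 set0); rewrite setU0 -[LHS]addr0 => /addrI/esym.
Qed.

Let c0E : (c set0)%:E = 0.
Proof. by rewrite c0. Qed.

Let cUD A B : c (A `|` B) = (c A + c (B `\` A))%R.
Proof. by rewrite -cU ?setDIK//; congr c; rewrite setUDr setDv setD0. Qed.

Let le_c A B : A `<=` B -> (c A <= c B)%R.
Proof. by move=> AB; rewrite -(setUidr AB) cUD lerDl. Qed.

Let c_leU A B : (c (A `|` B) <= c A + c B)%R.
Proof. by rewrite cUD lerD2l le_c//; exact: subDsetl. Qed.

(** By normality the disjoint closed sets F minus U and F minus V have disjoint open neighbourhoods;
    removing each of them from F leaves the two pieces. Subadditivity on open sets rests on this. *)
Let closed_split (F U V : set K) : closed F -> open U -> open V -> F `<=` U `|` V ->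
  exists F1 F2, [/\ closed F1, closed F2, F1 `<=` U, F2 `<=` V & F = F1 `|` F2].
Proof.
move=> clF oU oV FUV.
have clD W : open W -> closed (F `\` W).
  by move=> oW; rewrite setDE; apply: closedI => //; exact: open_closedC.
have [ | W1 [W2 [oO1 oO2 FW1 FW2 O12]]] :=
    (@normal_openP R K).1 (compact_normal hK cK) _ _ (clD _ oU) (clD _ oV).
  rewrite -subset0 => x [[Fx nUx] [_ nVx]]; case: (FUV _ Fx); contradiction.
exists (F `\` W1), (F `\` W2); split; [exact: clD|exact: clD| | |].
- by move=> x [Fx nx]; apply: contrapT => nUx; apply: nx; exact: FW1.
- by move=> x [Fx nx]; apply: contrapT => nUx; apply: nx; exact: FW2.
- by rewrite -setDIr O12 setD0.
Qed.

(** The content of an open set in the Riesz-Markov construction; closed sets stand for compact ones,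
    as [K] is compact Hausdorff. *)
Definition inner_content (U : set K) : \bar R :=
  ereal_sup [set (c F)%:E | F in [set F | closed F /\ F `<=` U]].

Let inner_content_ub U F : closed F -> F `<=` U -> (c F)%:E <= inner_content U.
Proof. by move=> clF FU; apply: ereal_sup_ubound; exists F. Qed.

Let inner_content_ge0 U : 0 <= inner_content U.
Proof.
by rewrite -c0E; apply: inner_content_ub; [exact: closed0|exact: sub0set].
Qed.

Let le_inner_content U V : U `<=` V -> inner_content U <= inner_content V.
Proof.
move=> UV; apply: ge_ereal_sup => _ [F [clF FU] <-].
by apply: inner_content_ub => //; exact: subset_trans FU UV.
Qed.

Let inner_content_le1 U : inner_content U <= 1.
Proof. by apply: ge_ereal_sup => _ [F _ <-]; rewrite lee_fin -cT le_c. Qed.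

(** A closed [F] inside the union is compact, so finitely many [U n] cover it, and [closed_split]
    cuts it into closed pieces inside each of them. *)
Let inner_content_bigcup (U : (set K)^nat) : (forall n, open (U n)) ->
  inner_content (\bigcup_n U n) <= \sum_(n <oo) inner_content (U n).
Proof.
move=> oU; apply: ge_ereal_sup => _ [F [clF FU] <-].
have finite_le n G : closed G -> G `<=` \bigcup_(i < n) U i ->
    (c G)%:E <= \sum_(0 <= i < n) inner_content (U i).
  elim: n G => [|n ih] G clG GU.
    by rewrite big_geq// -c0E lee_fin le_c//; apply: subset_trans GU _ => x [].
  have [ | | G1 [G2 [clG1 clG2 G1U G2U ->]]] :=
      @closed_split G (\bigcup_(i < n) U i) (U n) clG _ (oU n).
  - by apply: bigcup_open.
  - move=> x /GU[i /=]; rewrite ltnS leq_eqVlt => /predU1P[->|il] Uix; first by right.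
    by left; exists i.
  rewrite big_nat_recr//= (le_trans _ (leeD (ih _ clG1 G1U) (inner_content_ub clG2 G2U)))//.
  by rewrite lee_fin c_leU.
have := subclosed_compact clF cK (@subsetT _ F).
rewrite compact_cover => /(_ _ setT U (fun i _ => oU i) FU)[D _ FD].
(* The finite subcover is enlarged to an initial segment of indices, on which [finite_le] works by
   induction. *)
have FN : F `<=` \bigcup_(i < (\max_(i <- D) i).+1) U i.
  move=> x /FD[i /= iD Uix]; exists i => //=; rewrite ltnS.
  exact: (@leq_bigmax_seq _ _ xpredT id i).
rewrite (le_trans (finite_le _ _ clF FN))//.
by apply: nneseries_lim_ge => *; exact: inner_content_ge0.
Qed.

Definition outer_content (A : set K) : \bar R :=
  ereal_inf [set inner_content U | U in [set U | open U /\ A `<=` U]].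

Let outer_content_lb A U : open U -> A `<=` U -> outer_content A <= inner_content U.
Proof. by move=> oU AU; apply: ereal_inf_lbound; exists U. Qed.

Let outer_content_open U : open U -> outer_content U = inner_content U.
Proof.
move=> oU; apply/eqP; rewrite eq_le outer_content_lb//=.
by apply: le_ereal_inf_tmp => _ [V [oV UV] <-]; exact: le_inner_content.
Qed.

Let outer_content0 : outer_content set0 = 0.
Proof.
rewrite outer_content_open; last exact: open0.
apply/eqP; rewrite eq_le inner_content_ge0 andbT.
by apply: ge_ereal_sup => _ [F [_ F0] <-]; rewrite -c0E lee_fin le_c.
Qed.

Let outer_content_ge0 A : 0 <= outer_content A.
Proof. by apply: le_ereal_inf_tmp => _ [U _ <-]. Qed.

Let le_outer_content : {homo outer_content : A B / A `<=` B >-> A <= B}.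
Proof.
move=> A B AB; apply: le_ereal_inf_tmp => _ [U [oU BU] <-].
by apply: outer_content_lb => //; exact: subset_trans AB BU.
Qed.

Let outer_content_fin A : outer_content A \is a fin_num.
Proof.
rewrite ge0_fin_numE// (@le_lt_trans _ _ 1)// ?ltry//.
by rewrite (le_trans (outer_content_lb openT (@subsetT _ A))).
Qed.

Let outer_content_adherent A (e : R) : (0 < e)%R ->
  exists U, [/\ open U, A `<=` U & inner_content U <= outer_content A + e%:E].
Proof.
move=> e0; have [_ [U [oU AU] <-] Ue] :=
  lb_ereal_inf_adherent e0 (outer_content_fin A).
by exists U; split => //; exact: ltW.
Qed.

Let outer_content_sigma_subadditive : sigma_subadditive outer_content.
Proof.
move=> A; apply/lee_addgt0Pr => e e0.
have e_gt0 n : (0 < e / (2 ^ n.+1)%:R)%R by rewrite divr_gt0// ltr0n expn_gt0.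
have /choice[U UP] n := outer_content_adherent (A n) (e_gt0 n).
apply: le_trans (epsilon_trick _ _ (ltW e0)) => //.
apply: (@le_trans _ _ (\sum_(n <oo) inner_content (U n))); last first.
  by apply: lee_nneseries => [n _ _|n _]; [exact: inner_content_ge0|have [] := UP n].
apply: (@le_trans _ _ (inner_content (\bigcup_n U n))); last first.
  by apply: inner_content_bigcup => n; have [] := UP n.
apply: outer_content_lb; first by apply: bigcup_open => n _; have [] := UP n.
by move=> x [n _ Anx]; exists n => //; have [_ + _] := UP n; apply.
Qed.

Let om : {outer_measure set K -> \bar R} := HB.pack outer_content
  (isOuterMeasure.Build R K outer_content outer_content0 outer_content_ge0
    le_outer_content outer_content_sigma_subadditive).

(** Let [V] be open around [A]. A closed [F] inside [V] and [U] and a closed [G] inside [V] minus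
    [F] are disjoint, so [c F + c G] is at most the content of [V]. Suprema over [G], then over [F],
    give the splitting inequality. *)
Let open_caratheodory (U : set K) : open U -> om.-caratheodory U.
Proof.
move=> oU; apply: le_caratheodory_measurable => A.
apply: le_ereal_inf_tmp => _ [V [oV AV] <-].
have -> : om (A `&` U) = outer_content (A `&` U) by [].
have -> : om (A `&` ~` U) = outer_content (A `&` ~` U) by [].
apply: (@le_trans _ _ (inner_content (V `&` U) + outer_content (V `&` ~` U))).
  rewrite leeD ?le_outer_content//; last exact: setSI.
  by apply: outer_content_lb; [exact: openI|exact: setSI].
rewrite -leeBrDr ?outer_content_fin//; apply: ge_ereal_sup => _ [F [clF FVU] <-].
rewrite leeBrDr ?outer_content_fin// addeC -leeBrDr//.
apply: (@le_trans _ _ (inner_content (V `&` ~` F))).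
  apply: outer_content_lb; first by apply: openI => //; exact: closed_openC.
  by move=> x [Vx nUx]; split => // /FVU[_ /nUx].
apply: ge_ereal_sup => _ [G [clG GVF] <-].
rewrite leeBrDr// -EFinD -cU; last first.
  by rewrite -subset0 => x [/GVF[_ nFx] /nFx].
apply: inner_content_ub; first exact: closedU.
by move=> x [/GVF[]//|/FVU[]].
Qed.

Let borel_caratheodory (A : set K) :
  (@open K).-sigma.-measurable A -> om.-caratheodory A.
Proof.
apply: smallest_sub; last exact: open_caratheodory.
exact: (sigma_algebra_measurable (caratheodory_type om)).
Qed.

Local Notation BK := (g_sigma_algebraType (@open K)).

Let outer_content_sigma_additive :
  semi_sigma_additive (outer_content : set BK -> \bar R).
Proof.
move=> F mF tF mUF; apply: (caratheodory_measure_sigma_additive (mu := om)) => //.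
  by move=> n; exact: borel_caratheodory.
exact: borel_caratheodory.
Qed.

Let outer_contentT : outer_content setT = 1.
Proof.
rewrite outer_content_open; last exact: openT.
apply/eqP; rewrite eq_le inner_content_le1/= -cT.
by apply: inner_content_ub => //; exact: closedT.
Qed.

HB.instance Definition _ := isMeasure.Build _ BK R (outer_content : set BK -> \bar R)
  outer_content0 outer_content_ge0 outer_content_sigma_additive.

HB.instance Definition _ := Measure_isProbability.Build _ BK R
  (outer_content : set BK -> \bar R) outer_contentT.

Definition regular_extension : probability BK R := outer_content.

(** Outer regularity is built into the infimum. Inner regularity is outer regularity of the
    complement: an open set slightly larger than the complement of [A] has a compact complement
    inside [A]. *)
Lemma regular_extension_regular : regular_measure regular_extension.
Proof.
have outer A : regular_extension A =
    ereal_inf [set regular_extension U | U in [set U : set K | open U /\ A `<=` U]].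
  congr (ereal_inf _); apply/seteqP; split=> _ [U [oU AU] <-];
    by exists U => //; rewrite -outer_content_open.
move=> A mA; split; first exact: outer.
apply/eqP; rewrite eq_le; apply/andP; split; last first.
  apply: ge_ereal_sup => _ [F [_ FA] <-]; exact: le_outer_content.
have mCA : measurable (~` A : set BK) by exact: measurableC.
apply/lee_addgt0Pr => e e0; have [U [oU AU Ue]] := outer_content_adherent (~` A) e0.
have mU : measurable (U : set BK) by exact: sub_sigma_algebra.
apply: (@le_trans _ _ (regular_extension (~` U) + e%:E)); last first.
  rewrite leeD2r//; apply: ereal_sup_ubound; exists (~` U) => //; split.
    by apply: subclosed_compact cK _ => //; exact: open_closedC.
  exact: subsetCl.
rewrite [leLHS](_ : _ = 1 - regular_extension (~` A)); last first.
  by rewrite -probability_setC// setCK.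
rewrite (probability_setC regular_extension mU).
have : regular_extension U <= regular_extension (~` A) + e%:E.
  by rewrite (le_trans _ Ue)// -outer_content_open.
rewrite -(fineK (fin_num_measure regular_extension _ mU)).
rewrite -(fineK (fin_num_measure regular_extension _ mCA)).
set a := fine _; set b := fine _; rewrite -EFinD lee_fin => ab.
rewrite -[leLHS]/((1 - b)%:E) -[leRHS]/((1 - a + e)%:E) lee_fin; lra.
Qed.

Lemma le_regular_extension (F : set K) : closed F -> (c F)%:E <= regular_extension F.
Proof.
move=> clF; apply: le_ereal_inf_tmp => _ [U [oU FU] <-].
exact: inner_content_ub.
Qed.

End RegularExtension.

(** * The space of bounded functions *)

Section BoundedFunctions.
Variables (R : realType) (K : Type).

Definition bounded_functions : set (K -> R) :=
  [set f | exists M, forall x, `|f x| <= M].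

Definition is_bounded_function : pred (K -> R) := fun f => f \in bounded_functions.

Lemma is_bounded_function_submod_closed : submod_closed is_bounded_function.
Proof.
split; first by apply/mem_set; exists 0 => x; rewrite normr0.
move=> a f g /set_mem[M fM] /set_mem[N gN]; apply/mem_set.
exists (`|a| * M + N) => x; rewrite (le_trans (ler_normD _ _))//.
by rewrite lerD// normrM ler_wpM2l.
Qed.

HB.instance Definition _ := GRing.isSubmodClosed.Build R (K -> R)
  is_bounded_function is_bounded_function_submod_closed.

(** Discontinuous functions are included so that a functional can be evaluated at the indicator of
    any set. *)
Definition bfun := {f : K -> R | is_bounded_function f}.
HB.instance Definition _ := SubChoice.on bfun.
HB.instance Definition _ := [SubChoice_isSubLmodule of bfun by <:].

Lemma indic_bounded (A : set K) : is_bounded_function \1_A.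
Proof. by apply/mem_set; exists 1 => x; rewrite indicE ger0_norm// lern1 leq_b1. Qed.

Definition bindic (A : set K) : bfun := Sub \1_A (indic_bounded A).

End BoundedFunctions.

(** * Approximation of a number by the levels below it *)

Section Staircase.
Variables (R : realDomainType) (d : R).

(** For [0 < d] and [0 <= y] this is the minimum of [y] and [N%:R * d], rounded down to a multiple
    of [d]. *)
Let step N (y : R) := \sum_(k < N) d * (k.+1%:R * d <= y)%R%:R.

Let stepS N y : step N.+1 y = step N y + d * (N.+1%:R * d <= y)%R%:R.
Proof. by rewrite /step big_ord_recr. Qed.

Lemma staircase_le N y : 0 <= d -> 0 <= y -> step N y <= y.
Proof.
move=> d0; have stepN M : step M y <= M%:R * d.
  elim: M => [|M ih]; first by rewrite /step big_ord0 mul0r.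
  by rewrite stepS -natr1 mulrDl mul1r lerD// ler_piMr// lern1 leq_b1.
move=> y0; elim: N => [|N ih]; first by rewrite /step big_ord0.
rewrite stepS; case: (leP (N.+1%:R * d) y) => [Ny|_]; last by rewrite mulr0 addr0.
by rewrite mulr1 (le_trans _ Ny)// -natr1 mulrDl mul1r lerD2r.
Qed.

Lemma staircase_ge N y : y <= N.+1%:R * d -> y <= d + step N y.
Proof.
(* Truncating [y] removes the upper bound on it, so that induction on [N] goes through. *)
suff H : Num.min y (N.+1%:R * d) <= d + step N y.
  by move=> yN; rewrite (le_trans _ H)// le_min lexx.
elim: N => [|N ih].
  by rewrite /step big_ord0 addr0 mul1r ge_min lexx orbT.
rewrite stepS; case: (leP (N.+1%:R * d) y) => [Ny|yN].
  rewrite ge_min; apply/orP; right; rewrite mulr1 addrA -[N.+2%:R]natr1 mulrDl mul1r.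
  by rewrite lerD2r (le_trans _ ih)// le_min Ny lexx.
rewrite mulr0 addr0 ge_min; apply/orP; left.
by rewrite (le_trans _ ih)// le_min lexx ltW.
Qed.

End Staircase.

(** * Domination of a positive functional by a regular measure *)

Section RieszInequality.
Variables (R : realType) (K : ptopologicalType).
Hypotheses (hK : hausdorff_space K) (cK : compact [set: K]).
Local Notation BK := (g_sigma_algebraType (@open K)).

Lemma continuous_borel_measurable (f : K -> R) :
  continuous f -> measurable_fun [set: BK] (f : BK -> R).
Proof.
move=> cf; apply: (measurability _ (RGenOpens.measurableE R)).
move=> _ [_ [a [b ->] <-]]; rewrite setTI; apply: sub_sigma_algebra.
by move/continuousP : cf; apply; exact: interval_open.
Qed.

Lemma continuous_bounded (f : K -> R) : continuous f -> is_bounded_function f.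
Proof.
move=> cf; apply/mem_set.
have /compact_bounded[M [_ fM]] : compact (f @` setT).
  by apply: continuous_compact => //; exact: continuous_subspaceT.
exists (M + 1) => x; apply: (fM (M + 1)); first by rewrite ltrDl.
by exists x.
Qed.

Variable L : {scalar bfun R K}.
Hypothesis L_le : forall (v : bfun R K) b, (forall x, \val v x <= b) -> L v <= b.

Let LZ a u : L (a *: u) = a * L u.
Proof. exact: scalarZ. Qed.

Let L_ge0 (v : bfun R K) : (forall x, 0 <= \val v x) -> 0 <= L v.
Proof.
move=> v0; rewrite -oppr_le0 -raddfN; apply: L_le => x.
by rewrite raddfN fctE oppr_le0 v0.
Qed.

Let L_mono (u v : bfun R K) : (forall x, \val u x <= \val v x) -> L u <= L v.
Proof.
move=> uv; rewrite -subr_ge0 -raddfB; apply: L_ge0 => x.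
by rewrite raddfB !fctE subr_ge0 uv.
Qed.

Let c (A : set K) : R := L (bindic R A).

Let c_ge0 A : 0 <= c A.
Proof. by apply: L_ge0 => x; rewrite /= indicE. Qed.

Let cU A B : A `&` B = set0 -> c (A `|` B) = c A + c B.
Proof.
move=> AB; rewrite /c -raddfD; congr (L _); apply: val_inj; apply/funext => x.
rewrite /= fctE !indicE in_setU -natrD; congr (_ %:R).
have [xA|xA]/= := boolP (x \in A); last by rewrite add0n.
case: (boolP (x \in B)) => // xB.
have : (A `&` B) x by split; exact: set_mem.
by rewrite AB.
Qed.

Let cT : c setT = 1.
Proof.
apply/eqP; rewrite eq_le L_le/=; last by move=> x; rewrite indicE lern1 leq_b1.
(* The lower bound comes from [L_le] at the constant function -1. *)
rewrite -lerN2 /c -raddfN; apply: L_le => x.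
by rewrite raddfN/= fctE indicE in_setT.
Qed.

(** The superlevel sets [F k] of a continuous [v] are closed, so [mu] dominates [c] on them. With
    [S] the staircase of step [d] below [v], [L v] is at most [d + L S], hence at most [d] plus the
    integral of [S], hence at most [d] plus the integral of [v]; and [d] is arbitrary. *)
Lemma riesz_le : exists mu : probability BK R, regular_measure mu /\
  forall v : bfun R K, continuous (\val v) -> (forall x, 0 <= \val v x) ->
    ((L v)%:E <= \int[mu]_x (\val v x)%:E)%E.
Proof.
exists (regular_extension hK cK c_ge0 cU cT).
split; first exact: regular_extension_regular.
move=> v cv v0; set mu := regular_extension _ _ _ _ _.
have /set_mem[M vM] := valP v.
have mv := continuous_borel_measurable cv.
apply/lee_addgt0Pr => d d0.
(* Enough levels to pass the bound [M] of [v]; the one beyond [N] is the extra [d] in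
   [staircase_ge]. *)
have [N MN] : exists N : nat, M <= N.+1%:R * d.
  exists (Num.truncn (M / d)); rewrite -ler_pdivrMr// ltW//.
  exact: truncnS_gt.
pose F k := [set x | k.+1%:R * d <= \val v x].
have clF k : closed (F k).
  by apply: (closed_comp _ (@closed_ge _ (k.+1%:R * d))) => x _; exact: cv.
have mF k : measurable (F k : set BK).
  by rewrite -[F k]setCK; apply: measurableC; apply: sub_sigma_algebra; exact: closed_openC.
have FE k x : (k.+1%:R * d <= \val v x)%R%:R = \1_(F k) x :> R.
  by rewrite indicE; congr (nat_of_bool _)%:R; apply/idP/idP => [?|/set_mem//]; exact/mem_set.
pose S := \sum_(k < N) d *: bindic R (F k).
have SE x : \val S x = \sum_(k < N) d * (k.+1%:R * d <= \val v x)%R%:R.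
  rewrite /S raddf_sum fct_sumE; apply: eq_bigr => k _.
  by rewrite FE.
apply: (@le_trans _ _ (d%:E + \sum_(k < N) (d%:E * mu (F k)))%E).
  apply: (@le_trans _ _ (d * c setT + \sum_(k < N) d * c (F k))%:E).
    rewrite lee_fin (_ : _ + _ = L (d *: bindic R setT + S)); last first.
      rewrite raddfD raddf_sum; congr (_ + _); first exact/esym/LZ.
      by apply: eq_bigr => k _; exact/esym/LZ.
    apply: L_mono => x; rewrite raddfD/= fctE SE.
    rewrite [leRHS](_ : _ = d + \sum_(k < N) d * (k.+1%:R * d <= \val v x)%R%:R); last first.
      congr (_ + _); transitivity (d * \1_(@setT K) x); first by [].
      by rewrite indicT /cst mulr1.
    apply: staircase_ge.
    exact: le_trans (ler_norm _) (le_trans (vM x) MN).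
  rewrite EFinD cT mulr1 leeD2l// -sumEFin; apply: lee_sum => k _.
  by rewrite EFinM lee_wpmul2l ?lee_fin ?(ltW d0)// le_regular_extension.
rewrite addeC leeD2r//.
rewrite (_ : \sum_(k < N) _ = \int[mu]_x (\sum_(k < N) (d * \1_(F k) x)%:E))%E; last first.
  rewrite ge0_integral_sum//.
  - apply: eq_bigr => k _; under eq_integral do rewrite EFinM.
    rewrite ge0_integralZl ?lee_fin ?(ltW d0)//; last first.
      by apply/measurable_EFinP; exact: measurable_indic.
    by rewrite integral_indic// setIT.
  - by move=> k; apply/measurable_EFinP; apply: measurable_funM => //; exact: measurable_indic.
  - by move=> k x _; rewrite lee_fin mulr_ge0 ?(ltW d0)// indicE.
apply: ge0_le_integral => //.
- by move=> x _; apply: sume_ge0 => k _; rewrite lee_fin mulr_ge0 ?(ltW d0)// indicE.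
- apply: emeasurable_sum => k; apply/measurable_EFinP.
  by apply: measurable_funM => //; exact: measurable_indic.
- exact/measurable_EFinP.
move=> x _; rewrite sumEFin lee_fin.
under eq_bigr => k _ do rewrite -FE.
by apply: staircase_le; [exact: ltW|exact: v0].
Qed.

End RieszInequality.

(** * Existence of a dominating probability *)

Section Domination.
Variables (R : realType) (K : ptopologicalType).
Hypotheses (hK : hausdorff_space K) (cK : compact [set: K]).
Variables (I : Type) (f : I -> K -> R) (a : I -> R).
Hypotheses (f_cont : forall i, continuous (f i)) (f_ge0 : forall i x, 0 <= f i x).

Let G (s : seq (R * I)) x := \sum_(ti <- s) ti.1 * (f ti.2 x - a ti.2).

(* Ky Fan's lemma by Hahn-Banach: [L] is a linear functional below
   [v |-> inf_s sup (v + G s)], hence below [sup], and nonnegative on the [G s]. *)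
Lemma exists_dominating_probability :
  (forall s b, all (fun ti => 0 <= ti.1) s ->
    (forall x, \sum_(ti <- s) ti.1 * (f ti.2 x - a ti.2) <= b) -> 0 <= b) ->
  exists mu : probability (g_sigma_algebraType (@open K)) R, regular_measure mu /\
    forall i, ((a i)%:E <= \int[mu]_x (f i x)%:E)%E.
Proof.
move=> G_sup.
pose P (v : bfun R K) := [set b | exists2 s, all (fun ti : R * I => 0 <= ti.1) s &
  forall x, \val v x + G s x <= b].
have P_sup (v : bfun R K) b : (forall x, \val v x <= b) -> P v b.
  by move=> vb; exists [::] => // x; rewrite /G big_nil addr0.
(* If [v + G s <= b] and |v| is at most [M], then [G s <= b + M], so the hypothesis yields
   [- M <= b]. *)
have P_lb v : has_lbound (P v).
  have /set_mem[M vM] := valP v; exists (- M) => b [s s0 sb].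
  rewrite -subr_ge0 opprK; apply: (G_sup s) => // x.
  have := sb x; have := vM x; rewrite ler_norml => /andP[vMx _] ?.
  rewrite -/(G s x); lra.
have infP_sublinear : sublinear (fun v => inf (P v)).
  apply: sublinear_inf => //.
  - move=> v; have /set_mem[M vM] := valP v; exists M; apply: P_sup => x.
    exact: le_trans (ler_norm _) (vM x).
  - move=> u v b d [s s0 sb] [t t0 td]; exists (b + d) => //; exists (s ++ t).
      by rewrite all_cat s0.
    move=> x; rewrite raddfD fctE /G big_cat addrACA.
    by apply: lerD; [exact: sb|exact: td].
  - move=> e v b e0 [s s0 sb]; exists (e * b) => //.
    exists [seq (e * ti.1, ti.2) | ti <- s].
      by rewrite all_map; apply: sub_all s0 => ti /= ti0; rewrite mulr_ge0// ltW.
    move=> x; rewrite (_ : _ + _ = e * (\val v x + G s x)) ?ler_wpM2l ?(ltW e0)//.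
    rewrite mulrDr; congr (_ + _).
    by rewrite /G big_map mulr_sumr; apply: eq_bigr => ti _; rewrite mulrA.
have [L LP] := hahn_banach infP_sublinear.
have L_inf v b : P v b -> L v <= b.
  by move=> Pvb; apply: le_trans (LP v) _; exact: ge_inf.
have [mu [rmu muL]] := riesz_le hK cK (fun v b vb => L_inf v b (P_sup v b vb)).
exists mu; split => // i.
pose fi : bfun R K := Sub (f i) (continuous_bounded cK (f_cont (i := i))).
apply: le_trans (muL fi (f_cont (i := i)) (f_ge0 i)); rewrite lee_fin -lerN2 -raddfN.
(* With the single term [(1, i)], the function [- f i + G s] is the constant [- a i]. *)
apply: L_inf; exists [:: (1, i)]; first by rewrite /= ler01.
by move=> x; rewrite /G big_seq1 raddfN fctE mul1r /= addrA addNr add0r.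
Qed.

End Domination.

(** * Convergence of filters in initial and product topologies *)

Lemma cvg_initial (S : choiceType) (T : topologicalType) (f : S -> T)
    (F : set_system S) (s : S) :
  Filter F -> f @ F --> f s -> F --> (s : initial_topology f).
Proof.
move=> FF Ff A; rewrite nbhsE => -[_ [[C oC <-] Cs] sA].
by apply: filterS sA _; apply: Ff; exact: open_nbhs_nbhs.
Qed.

Lemma cvg_prod_topology (I : Type) (T : I -> topologicalType)
    (F : set_system (forall i, T i)) (t : forall i, T i) :
  Filter F -> (forall i, f i @[f --> F] --> t i) ->
  F --> (t : prod_topology T).
Proof.
by move=> FF Ft; apply/cvg_sup => i; apply: cvg_initial; exact: Ft.
Qed.

(** * Continuity and boundedness of multilinear mappings *)

Section MultilinearContinuity.
Variables (R : realType) (m : nat) (X : 'I_m -> completeNormedModType R).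

Lemma multilinearB (W : lmodType R) (f : (forall j, X j) -> W) x j u v :
  multilinear f -> f (dfwith x j (u - v)) = f (dfwith x j u) - f (dfwith x j v).
Proof.
have -> : u - v = -1 *: v + u by rewrite scaleN1r addrC.
by move=> fL; rewrite fL scaleN1r addrC.
Qed.

Lemma dfwith_id (x : forall j, X j) i : dfwith x i (x i) = x.
Proof. by apply: functional_extensionality_dep => j; case: dfwithP. Qed.

(* Telescoping: the coordinates in [s] are moved from [a] to [x] one at a time. *)
Lemma multilinear_dist (W : normedModType R) (f : (forall j, X j) -> W) M a x :
  multilinear f -> 0 <= M -> (forall x, `|f x| <= M * \prod_(j < m) `|x j|) ->
  (forall j, `|x j - a j| <= 1) ->
  `|f x - f a| <= (M * \prod_(j < m) (`|a j| + 1)) * \sum_(j < m) `|x j - a j|.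
Proof.
move=> fL M0 fM xa1; set B := M * _.
have B0 : 0 <= B by rewrite mulr_ge0// prodr_ge0// => j _; rewrite addr_ge0.
pose mix (s : seq 'I_m) : forall j, X j := fun j => if j \in s then x j else a j.
suff H s : uniq s -> `|f (mix s) - f a| <= B * \sum_(j <- s) `|x j - a j|.
  have := H _ (enum_uniq 'I_m); rewrite big_enum; congr (`|f _ - _| <= _).
  by apply: functional_extensionality_dep => j; rewrite /mix mem_enum.
elim: s => [_|i s ih /= /andP[iNs us]].
  have -> : mix [::] = a by apply: functional_extensionality_dep.
  by rewrite big_nil mulr0 subrr normr0.
have mixE : mix (i :: s) = dfwith (mix s) i (x i).
  apply: functional_extensionality_dep => j; rewrite /mix inE.
  case: dfwithP => [|j' ij']; first by rewrite eqxx.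
  by rewrite eq_sym (negbTE ij').
have mixi : mix s = dfwith (mix s) i (a i).
  by rewrite -[in LHS](dfwith_id (mix s) i) {2}/mix (negbTE iNs).
rewrite big_cons mulrDr -(subrKA (f (mix s))) (le_trans (ler_normD _ _))// lerD ?ih//.
have -> : f (mix (i :: s)) - f (mix s) = f (dfwith (mix s) i (x i - a i)).
  by rewrite multilinearB// -mixE -mixi.
rewrite (le_trans (fM _))//.
rewrite /B -mulrA ler_wpM2l// mulrC (bigD1 i)//= dfwithin.
rewrite [X in _ <= _ * X](bigD1 i)//= mulrA ler_pM//; first exact: prodr_ge0.
  by rewrite ler_peMr// lerDr.
apply: ler_prod => j ji; rewrite normr_ge0/= dfwithout 1?eq_sym//.
rewrite /mix; case: ifP => _; last by rewrite lerDl.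
by rewrite -lerBlDl (le_trans (lerB_dist _ _)).
Qed.

Lemma bounded_multilinear_continuous (W : normedModType R)
    (f : (forall j, X j) -> W) M :
  multilinear f -> (forall x, `|f x| <= M * \prod_(j < m) `|x j|) ->
  continuous (f : prod_topology (fun j => X j) -> W).
Proof.
move=> fL fM a.
wlog M0 : M fM / 0 <= M.
  move/(_ `|M|); apply => // x; apply: le_trans (fM x) _.
  by rewrite ler_wpM2r ?ler_norm// prodr_ge0.
have FF := @nbhs_filter (prod_topology (fun j => X j)) a.
apply/cvgrPdist_le => e e0.
set B := M * \prod_(j < m) (`|a j| + 1).
have B0 : 0 <= B by rewrite mulr_ge0// prodr_ge0// => j _; rewrite addr_ge0.
(* The bound 1 makes [multilinear_dist] applicable; the [+ 1] keeps the denominator positive when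
   [B * m%:R] is 0. *)
pose d := Num.min 1 (e / (B * m%:R + 1)).
have Bm : 0 < B * m%:R + 1 by rewrite ltr_wpDl// mulr_ge0.
have d0 : 0 < d by rewrite lt_min ltr01 divr_gt0.
have : \forall x \near (a : prod_topology (fun j => X j)), forall j, `|x j - a j| <= d.
  apply: (filter_forall FF) => j.
  have /cvgrPdist_le/(_ _ d0) := @proj_continuous _ (fun j => X j) j a.
  by apply: filterS => x; rewrite distrC.
apply: filterS => x xd; rewrite distrC.
have xa1 j : `|x j - a j| <= 1 by rewrite (le_trans (xd j))// ge_min lexx.
rewrite (le_trans (multilinear_dist fL M0 fM xa1))// -/B.
rewrite (@le_trans _ _ (B * (m%:R * d)))//.
  rewrite ler_wpM2l// (le_trans (ler_sum _ (fun j _ => xd j)))//.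
  by rewrite sumr_const card_ord mulr_natl.
rewrite mulrA (@le_trans _ _ ((B * m%:R + 1) * (e / (B * m%:R + 1))))//.
  apply: ler_pM; [by rewrite mulr_ge0|exact: ltW|by rewrite lerDl|].
  by rewrite ge_min lexx orbT.
by rewrite mulrCA divff ?mulr1// gt_eqF.
Qed.

(** Continuity at 0 bounds |f| by 1 on a box of radius 1/(n+1); rescaling each of the [m]
    coordinates produces the constant (n+1)^m. *)
Lemma continuous_multilinear_bounded (W : normedModType R)
    (f : (forall j, X j) -> W) : (0 < m)%N -> continuous_multilinear f ->
  exists2 M, 0 < M & forall x, `|f x| <= M * \prod_(j < m) `|x j|.
Proof.
move=> m0 [fL fc].
(* All coordinates are scaled by 0; as [0 < m], the product of the scalars is 0 and not the empty
   product 1. *)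
have f0 : f (fun=> 0) = 0.
  have := multilinear_scale (fun=> 0) (fun=> 0 : R) fL.
  rewrite (bigD1 (Ordinal m0))//= mul0r scale0r => <-; congr f.
  by apply: functional_extensionality_dep => j; rewrite scaler0.
have [n fn] : exists n : nat, forall x, (forall j, `|x j| <= n.+1%:R^-1) -> `|f x| < 1.
  (* Otherwise points of shrinking boxes at which |f| is at least 1 tend to 0, against continuity
     there. *)
  apply: contrapT => /forallNP H.
  have /choice[x xP] n : exists x, (forall j, `|x j| <= n.+1%:R^-1) /\ 1 <= `|f x|.
    move/existsNP: (H n) => [x /not_implyP[xn /negP]]; rewrite -leNgt => fx.
    by exists x.
  have x0 : x n @[n --> \oo] --> ((fun=> 0) : prod_topology (fun j => X j)).
    apply: cvg_prod_topology => j; apply/cvgr0Pnorm_le => e e0.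
    have [M _ hM] := near_infty_natSinv_lt (PosNum e0).
    exists M => // k Mk /=; rewrite (le_trans ((xP k).1 j))// ltW//; exact: hM.
  have /cvgrPdist_lt/(_ _ ltr01) := cvg_comp _ _ x0 (fc _).
  rewrite f0 => -[N _ /(_ _ (leqnn N))]/=; rewrite sub0r normrN ltNge.
  by rewrite (xP N).2.
exists (n.+1%:R ^+ m); first by rewrite exprn_gt0.
move=> x.
have fS y : (forall j, `|y j| <= 1) -> `|f y| <= n.+1%:R ^+ m.
  move=> y1; have := fn (fun j => n.+1%:R^-1 *: y j).
  rewrite (multilinear_scale _ _ fL) prodr_const card_ord normrZ.
  rewrite ger0_norm ?exprn_ge0// exprVn ltr_pdivrMl ?exprn_gt0// mulr1 => h.
  apply/ltW/h => j; rewrite normrZ ger0_norm//.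
  by rewrite -[leRHS]mulr1 ler_wpM2l ?y1.
have xE j : `|x j| *: (`|x j|^-1 *: x j) = x j.
  have [->|xj0] := eqVneq (x j) 0; first by rewrite !scaler0.
  by rewrite scalerA divff ?normr_eq0// scale1r.
have fxE : (fun j => `|x j| *: (`|x j|^-1 *: x j)) = x.
  by apply: functional_extensionality_dep.
rewrite -{1}fxE.
rewrite (multilinear_scale _ _ fL) normrZ ger0_norm ?prodr_ge0// mulrC.
rewrite ler_wpM2r ?prodr_ge0// fS// => j; rewrite normrZ normfV normr_id.
have [->|xj0] := eqVneq (x j) 0; first by rewrite normr0 mulr0.
by rewrite mulVf// normr_eq0.
Qed.

End MultilinearContinuity.

(** * The weak* topology of the unit ball of forms *)

Section WeakStarBall.
Variables (R : realType) (m : nat) (X : 'I_m -> completeNormedModType R).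
Local Notation mball := (mball X).
Local Notation wball := (wball X).

Lemma wball_hausdorff : hausdorff_space wball.
Proof.
move=> phi psi phipsi; apply: val_inj; apply/funext => x.
apply: (@Rhausdorff R) => A B nA nB.
have nA' : nbhs (phi : wball) (elem x @^-1` A) by exact: elem_continuous.
have nB' : nbhs (psi : wball) (elem x @^-1` B) by exact: elem_continuous.
by have [chi [Achi Bchi]] := phipsi _ _ nA' nB'; exists (elem x chi).
Qed.

(** The way to produce points of the ball: the estimate alone already yields continuity. *)
Lemma bounded_multilinear_form_ball (f : (forall j, X j) -> R) :
  multilinear f -> (forall x, `|f x| <= \prod_(j < m) `|x j|) -> f \in form_ball (X := X).
Proof.
move=> fL f1; apply/mem_set; split.
  split=> //; apply: (@bounded_multilinear_continuous _ _ _ _ _ 1) => // x.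
  by rewrite mul1r.
apply: ge_ereal_sup => _ [x x1 <-]; rewrite lee_fin (le_trans (f1 x))//.
by apply: prodr_ile1 => j _; rewrite normr_ge0 x1.
Qed.

(** Evaluation at [phi] is 1-Lipschitz for the projective norm on [Vm], and this passes to limits of
    Cauchy sequences. The bound is uniform in [phi], as needed to carry convergence from [Vm] to
    [ptensor]. *)
Lemma pairing_dist (phi : mball) (u : ptensor X) (v : Vm X) :
  `|pairing phi u - \val v phi| <= `|u - cembed _ v|.
Proof.
set w := crepr u.
have Vdist (s t : Vm X) : `|\val s phi - \val t phi| <= proj_norm X (s - t).
  exact: (Vm_le (s - t)).
have /cvg_ex[l wl] : cvgn (fun n => \val (\val w n) phi).
  apply/cauchy_cvgP/cauchyP => e e0; have [M hM] := cauchy_seqP w e0.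
  exists (\val (\val w M) phi); exists M => //= n Mn.
  by apply: le_lt_trans (Vdist _ _) _; exact: hM.
have -> : pairing phi u = l by exact: cvg_lim.
have hl : `|\val (\val w n) phi - \val v phi| @[n --> \oo] --> `|l - \val v phi|.
  by apply: cvg_norm; apply: cvgB => //; exact: cvg_cst.
have hr := @cvg_cnorm _ _ _ (w - Sub (fun=> v) (const_cauchy _ v)).
have -> : `|u - cembed _ v| =
    cnorm (cclass (w - Sub (fun=> v) (const_cauchy _ v))).
  by rewrite cclassB creprK.
by apply: ler_cvg_to hl hr _; apply: nearW => n; exact: Vdist.
Qed.

(** Banach-Alaoglu by ultrafilters: the values at each [x] stay in a compact interval, hence
    converge, and the limit inherits multilinearity and the norm bound. Density of [Vm] in [ptensor]
    then turns pointwise into weak* convergence. *)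
Lemma wball_compact : compact [set: wball].
Proof.
rewrite compact_ultra => F FU _.
have FF : ProperFilter F := @ultra_proper _ F FU.
have /choice[f Ff] x : exists l, elem x phi @[phi --> F] --> (l : R).
  pose b := \prod_(j < m) `|x j|.
  have bF : (elem x @ F) `[- b, b]%classic.
    by apply: (@filterE _ F) => phi /=; rewrite in_itv/= -ler_norml; exact: mball_le.
  (* For an ultrafilter a cluster point is a limit: otherwise the complement of some neighbourhood
     would belong to the image filter. *)
  have [l [_ cl]] := segment_compact _ bF.
  exists l => A nA.
  have [//|FA] := in_ultra_setVsetC (elem x @^-1` A) FU.
  by have [z [nAz /nAz]] := cl (~` A) A FA nA.
have fL : multilinear f.
  move=> x j a u v; apply: (cvg_unique _ (Ff _)) => //.
  have -> : elem (dfwith x j (a *: u + v)) =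
      (fun phi : mball => a * elem (dfwith x j u) phi + elem (dfwith x j v) phi).
    by apply/funext => phi; exact: (mball_multilinear phi).
  by apply: cvgD => //; apply: cvgM => //; exact: cvg_cst.
have f1 x : `|f x| <= \prod_(j < m) `|x j|.
  have nF : `|elem x phi| @[phi --> F] --> `|f x| by exact: cvg_norm.
  by apply: (cvgr_to_le nF); apply: (@filterE _ F) => phi; exact: mball_le.
pose phi0 : mball := Sub f (bounded_multilinear_form_ball fL f1).
exists (phi0 : wball); split => //.
apply: cvg_initial; apply: cvg_prod_topology => u.
have FV (v : Vm X) : \val v phi @[phi --> F] --> \val v phi0.
  have [n [lam [x ->]]] := VmP v; rewrite raddf_sum !fct_sumE.
  apply: cvg_big => [|k _]; first exact: add_continuous.
  apply: cvgM; [exact: cvg_cst|exact: Ff].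
apply/cvgrPdist_lt => e e0; have e30 : 0 < e / 3 by rewrite divr_gt0.
have [v uv] := cembed_dense u e30.
have /cvgrPdist_lt/(_ _ e30) := FV v.
apply: filterS => phi vphi.
suff : `|pairing phi0 u - pairing phi u| < e by [].
have h := pairing_dist phi u v; have h0 := pairing_dist phi0 u v.
rewrite [X in `|X|](_ : _ = (pairing phi0 u - \val v phi0) + (\val v phi0 - \val v phi) -
  (pairing phi u - \val v phi)); last by ring.
rewrite (le_lt_trans (ler_normB _ _))//.
rewrite (le_lt_trans (lerD (ler_normD _ _) (lexx _)))//; lra.
Qed.

End WeakStarBall.

(** * Extension of operators to a completion, and norming functionals *)

Lemma completion_extend (R : realType) (V : lmodType R) (N : seminorm V)
    (Y : completeNormedModType R) (S : {linear V -> Y}) (C : R) :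
  (forall v, `|S v| <= C * N v) ->
  exists That : {linear completion N -> Y},
    continuous That /\ forall v, That (cembed N v) = S v.
Proof.
move=> SC.
wlog C0 : C SC / 0 < C.
  move/(_ (`|C| + 1)); apply; last by rewrite ltr_wpDl.
  move=> v; apply: le_trans (SC v) _; rewrite ler_wpM2r ?snorm_ge0//.
  by rewrite (le_trans (ler_norm _))// lerDl.
(* A bounded operator sends Cauchy sequences to Cauchy sequences, which converge in [Y], and null
   sequences to null ones, so the limit depends only on the class. *)
pose lift (u : cauchy_seq N) := lim (S (\val u n) @[n --> \oo]).
have lift_cvg u : S (\val u n) @[n --> \oo] --> lift u.
  apply/cauchy_cvgP/cauchyP => e e0.
  have [M hM] := cauchy_seqP u (divr_gt0 e0 C0).
  exists (S (\val u M)); exists M => //= n Mn.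
  rewrite -ball_normE /ball_/= -raddfB (le_lt_trans (SC _))//.
  by rewrite mulrC -ltr_pdivlMr// hM.
have liftP u l : S (\val u n) @[n --> \oo] --> l -> lift u = l by exact: cvg_lim.
have lift_eq u v : cclass u = cclass v -> lift u = lift v.
  move=> /cclass_eq uv; apply: liftP.
  have uv0 : S (\val u n - \val v n) @[n --> \oo] --> 0.
    apply/norm_cvg0P.
    apply: (@squeeze_cvgr _ _ _ _ (cst 0) (fun n => C * N (\val u n - \val v n))).
    - by apply: nearW => n; rewrite normr_ge0 SC.
    - exact: cvg_cst.
    - by rewrite -(mulr0 C); apply: cvgM => //; exact: cvg_cst.
  have -> : (fun n => S (\val u n)) =
      (fun n => S (\val v n) + S (\val u n - \val v n)).
    by apply/funext => n; rewrite raddfB addrC subrK.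
  by rewrite -[lift v]addr0; apply: cvgD.
pose That x := lift (crepr x).
have ThatE u : That (cclass u) = lift u by apply: lift_eq; exact: creprK.
have ThatL : linear That.
  move=> a x y; rewrite -(creprK x) -(creprK y) -[a *: _]cclassZ -cclassD !ThatE.
  apply: liftP.
  have -> : (fun n => S (\val (a *: crepr x + crepr y) n)) =
      (fun n => a *: S (\val (crepr x) n) + S (\val (crepr y) n)).
    by apply/funext => n; rewrite /= !fctE linearP.
  by apply: cvgD => //; apply: cvgZ => //; exact: cvg_cst.
have Thatb x : `|That x| <= C * `|x|.
  rewrite -(creprK x) ThatE.
  have nS : `|S (\val (crepr x) n)| @[n --> \oo] --> `|lift (crepr x)|.
    exact: cvg_norm.
  have nN : C * N (\val (crepr x) n) @[n --> \oo] --> C * `|cclass (crepr x)|.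
    by apply: cvgM; [exact: cvg_cst|exact: cnorm_cclass].
  by apply: ler_cvg_to nS nN _; apply: nearW => n; exact: SC.
pose ThatLin := GRing.isLinear.Build R (completion N) Y _ That ThatL.
pose ThatP : {linear completion N -> Y} := HB.pack That ThatLin.
exists ThatP; split.
  apply/bounded_linear_continuous/linear_boundedP.
  exists C; split => [|r Cr x]; first exact: num_real.
  by rewrite (le_trans (Thatb x))// ler_wpM2r// ltW.
move=> v; apply: (etrans (ThatE _)); apply: liftP.
by under eq_cvg do rewrite SubK; exact: cvg_cst.
Qed.

(** The infimum over t of |z + t y| - t |y| is at most |z|, and at [- y] the choice t = 1 makes it
    at most -|y|. A linear functional below it therefore satisfies L y = |y|. *)
Lemma norming_functional (R : realType) (Y : normedModType R) (y : Y) :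
  exists L : {scalar Y}, L y = `|y| /\ forall z, `|L z| <= `|z|.
Proof.
pose P z := [set `|z + t *: y| - t * `|y| | t in [set t : R | 0 <= t]].
have P_lb z : lbound (P z) (- `|z|).
  move=> _ [t /= t0 <-]; rewrite lerBrDl -{1}(ger0_norm t0) -normrZ.
  by rewrite lerBlDl -{1}(addKr z (t *: y)) -(normrN z) ler_normD.
have P_in z t : 0 <= t -> inf (P z) <= `|z + t *: y| - t * `|y|.
  by move=> t0; apply: ge_inf; [exists (- `|z|)|exists t].
have infP_sublinear : sublinear (fun z => inf (P z)).
  apply: sublinear_inf.
  - by move=> z; exists (`|z + 0 *: y| - 0 * `|y|), 0 => /=.
  - by move=> z; exists (- `|z|).
  - move=> u v _ _ [t /= t0 <-] [r /= r0 <-].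
    exists (`|u + v + (t + r) *: y| - (t + r) * `|y|).
      by exists (t + r) => //=; rewrite addr_ge0.
    by rewrite scalerDl addrACA mulrDl opprD [leRHS]addrACA lerD2r ler_normD.
  - move=> a v _ a0 [t /= t0 <-].
    exists (`|a *: v + (a * t) *: y| - (a * t) * `|y|).
      by exists (a * t) => //=; rewrite mulr_ge0// ltW.
    by rewrite -scalerA -scalerDr normrZ gtr0_norm// -mulrA mulrBr.
have [L LP] := hahn_banach infP_sublinear.
have L_le z : L z <= `|z|.
  by rewrite (le_trans (LP z))// (le_trans (P_in z 0 _))// scale0r addr0 mul0r subr0.
exists L; split; last first.
  by move=> z; rewrite ler_norml L_le andbT lerNl -raddfN -normrN L_le.
apply/eqP; rewrite eq_le L_le/= -lerN2 -raddfN (le_trans (LP _))//.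
by rewrite (le_trans (P_in _ 1 ler01))// scale1r addNr normr0 mul1r sub0r.
Qed.

(** * Linearization of [T] on [Vm] *)

Section TensorLift.
Variables (R : realType) (m : nat) (X : 'I_m -> completeNormedModType R).
Variables (Y : normedModType R) (T : (forall j, X j) -> Y).
Hypotheses (m0 : (0 < m)%N) (T_mult : continuous_multilinear T).

(* Hahn-Banach: the [L \o T] with [L] in the dual of [Y] separate the points of
   [Y], and up to a scalar they belong to the ball. *)
Lemma tensor_lift_unique n (lam : 'I_n -> R) x n' (mu : 'I_n' -> R) z :
  \sum_(k < n) lam k *: imap (x k) = \sum_(k < n') mu k *: imap (z k) ->
  \sum_(k < n) lam k *: T (x k) = \sum_(k < n') mu k *: T (z k).
Proof.
move=> xz; apply/eqP; rewrite -subr_eq0 -normr_eq0; apply/eqP.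
have [M M0 TM] := continuous_multilinear_bounded m0 T_mult.
have [L [<- L1]] := norming_functional
  (\sum_(k < n) lam k *: T (x k) - \sum_(k < n') mu k *: T (z k)).
have LZ (a : R) (u : Y) : L (a *: u) = a * L u by exact: scalarZ.
pose f y := M^-1 * L (T y).
have fL : multilinear f.
  move=> y j a u v; rewrite /f T_mult.1 raddfD mulrDr; congr (_ + _).
  transitivity (M^-1 * (a * L (T (dfwith y j u)))); last exact: mulrCA.
  by congr (_ * _); exact: LZ.
have f1 y : `|f y| <= \prod_(j < m) `|y j|.
  rewrite normrM gtr0_norm ?invr_gt0// ler_pdivrMl//.
  exact: le_trans (L1 _) (TM y).
pose phi : mball X := Sub f (bounded_multilinear_form_ball fL f1).
have LE k (nu : 'I_k -> R) y :
    L (\sum_(i < k) nu i *: T (y i)) = M * \val (\sum_(i < k) nu i *: imap (y i)) phi.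
  rewrite raddf_sum raddf_sum fct_sumE mulr_sumr; apply: eq_bigr => i _.
  transitivity (nu i * L (T (y i))); first exact: LZ.
  transitivity (M * (nu i * (M^-1 * L (T (y i))))); last by [].
  by rewrite mulrCA [M * _]mulrA divff ?mul1r// gt_eqF.
rewrite raddfB; apply/eqP; rewrite subr_eq0; apply/eqP.
by apply: etrans (LE _ _ _) _; rewrite xz; exact/esym/LE.
Qed.

(** The value at [v] is read off any representation of [v], by [tensor_lift_unique]; concatenating
    representations gives linearity. *)
Lemma tensor_lift :
  exists S : {linear Vm X -> Y}, forall x, S (imap x) = T x.
Proof.
have /choice[S SP] v : exists y : Y, forall n (lam : 'I_n -> R) x,
    v = \sum_(k < n) lam k *: imap (x k) -> y = \sum_(k < n) lam k *: T (x k).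
  have [n [lam [x vE]]] := VmP v; exists (\sum_(k < n) lam k *: T (x k)).
  by move=> n' mu z; rewrite vE; exact: tensor_lift_unique.
have S_linear : linear S.
  move=> a u v; have [n [lam [x uE]]] := VmP u; have [k [mu [z vE]]] := VmP v.
  rewrite (SP _ _ _ _ uE) (SP _ _ _ _ vE).
  have splitl (i : 'I_n) : fintype.split (lshift k i) = inl i.
    by rewrite -[lshift _ _]/(unsplit (inl _)) unsplitK.
  have splitr (i : 'I_k) : fintype.split (rshift n i) = inr i.
    by rewrite -[rshift _ _]/(unsplit (inr _)) unsplitK.
  rewrite (SP _ (n + k)%N
    (fun i => match fintype.split i with inl i => a * lam i | inr i => mu i end)
    (fun i => match fintype.split i with inl i => x i | inr i => z i end)).
    rewrite big_split_ord scaler_sumr; congr (_ + _); apply: eq_bigr => i _.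
      by rewrite splitl scalerA.
    by rewrite splitr.
  rewrite uE vE big_split_ord scaler_sumr; congr (_ + _); apply: eq_bigr => i _.
    by rewrite splitl scalerA.
  by rewrite splitr.
pose SLin := GRing.isLinear.Build R (Vm X) Y _ S S_linear.
pose Sp : {linear Vm X -> Y} := HB.pack S SLin.
exists Sp => x; rewrite -[T x]scale1r.
have := SP (imap x) 1%N (fun=> 1) (fun=> x); rewrite !big_ord1 scale1r; exact.
Qed.

End TensorLift.

(** * Real powers and padding of finite families *)

Section Powers.
Variable R : realType.

(** Away from 0 the power is differentiable. At 0 it need not be, and the radius e^(1/a) is used
    directly. *)
Lemma continuous_norm_powR (a : R) : 0 < a -> continuous (fun t : R => `|t| `^ a).
Proof.
move=> a0 t; have [->|t0] := eqVneq t 0.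
  rewrite /continuous_at normr0 powR0 ?gt_eqF//.
  apply/cvgr0Pnorm_lt => e e0.
  have ea0 : 0 < e `^ a^-1 by rewrite powR_gt0.
  have := @nbhs0_lt R R _ ea0; apply: filterS => z ze.
  rewrite ger0_norm ?powR_ge0// -[ltRHS](@powRr1 _ e) ?(ltW e0)//.
  rewrite -[in ltRHS](mulVf (lt0r_neq0 a0)) powRrM.
  by rewrite gt0_ltr_powR ?nnegrE ?normr_ge0 ?powR_ge0.
have t0' : 0 < `|t| by rewrite normr_gt0.
apply: (@continuous_comp _ _ _ (fun t : R => `|t|) (fun t => t `^ a)).
  exact: norm_continuous.
apply: differentiable_continuous; apply/derivable1_diffP; apply: derivable_powR.
by rewrite in_itv/= andbT.
Qed.

Lemma powRK (x q : R) : 0 <= x -> q != 0 -> (x `^ q) `^ q^-1 = x.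
Proof. by move=> x0 q0; rewrite -powRrM divff// powRr1. Qed.

Lemma powRVK (x q : R) : 0 <= x -> q != 0 -> (x `^ q^-1) `^ q = x.
Proof. by move=> x0 q0; rewrite -powRrM mulVf// powRr1. Qed.

End Powers.

(** Assertion (1) speaks of rectangular families, while the combinations met in its use have
    different lengths; zero coefficients make them equally long. *)
Definition pad W (w : W) n (F : 'I_n -> W) (k : nat) : W := oapp F w (insub k).

Lemma sum_pad (V : nmodType) n N (F : 'I_n -> V) : (n <= N)%N ->
  \sum_(k < N) pad 0 F k = \sum_(k < n) F k.
Proof.
move=> nN; transitivity (\sum_(k < n) pad 0 F k).
  rewrite (@big_ord_widen _ _ _ n N (pad 0 F))// [RHS]big_mkcond; apply: eq_bigr => k _.
  by case: ifPn => // kn; rewrite /pad insubF//; exact: negbTE.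
by apply: eq_bigr => k _; rewrite /pad valK.
Qed.

Lemma lincomb_pad (R : pzRingType) (V : lmodType R) W (w : W) (T : W -> V) (c : R)
    n N (lam : 'I_n -> R) (x : 'I_n -> W) : (n <= N)%N ->
  \sum_(k < N) (c * pad 0 lam k) *: T (pad w x k) = c *: \sum_(k < n) lam k *: T (x k).
Proof.
move=> nN; rewrite scaler_sumr -(sum_pad _ nN); apply: eq_bigr => k _.
rewrite /pad; case: insub => [i|]/=; first by rewrite scalerA.
by rewrite mulr0 scale0r.
Qed.

(** * Continuity and integrability of the weights *)

Section WeightNorm.
Variables (R : realType) (m : nat) (X : 'I_m -> completeNormedModType R).
Variables p sigma : R.
Hypotheses (p1 : 1 <= p) (sigma1 : sigma < 1).
Let q := p / (1 - sigma).
Local Notation wball := (wball X).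

Lemma exponent_gt0 : 0 < q.
Proof. by rewrite divr_gt0 ?subr_gt0// (lt_le_trans ltr01). Qed.

Lemma continuous_weight n (lam : 'I_n -> R) (x : 'I_n -> forall j, X j) :
  continuous (weight sigma lam x : wball -> R).
Proof.
move=> phi; have FF := @nbhs_filter wball phi.
apply: cvg_big => [|k _]; first exact: add_continuous.
apply: cvgM; last exact: cvg_cst.
apply: cvgM; first exact: cvg_cst.
apply: (@continuous_comp _ _ _ (elem (x k) : wball -> R) (fun t => `|t| `^ (1 - sigma))).
  exact: elem_continuous.
by apply: continuous_norm_powR; rewrite subr_gt0.
Qed.

Lemma continuous_weight_powR n (lam : 'I_n -> R) (x : 'I_n -> forall j, X j) :
  continuous (fun phi : wball => `|weight sigma lam x phi| `^ q).
Proof.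
move=> phi.
apply: (@continuous_comp _ _ _ (weight sigma lam x : wball -> R) (fun t => `|t| `^ q)).
  exact: continuous_weight.
exact: continuous_norm_powR exponent_gt0 _.
Qed.

Lemma weight_pad (c : R) n N (lam : 'I_n -> R) (x : 'I_n -> forall j, X j) phi :
  (n <= N)%N ->
  weight sigma (fun k : 'I_N => c * pad 0 lam k) (fun k => pad (fun=> 0) x k) phi =
    `|c| * weight sigma lam x phi.
Proof.
move=> nN; rewrite /weight mulr_sumr -(sum_pad _ nN); apply: eq_bigr => k _.
rewrite /pad; case: insub => [i|]/=; first by rewrite normrM !mulrA.
by rewrite mulr0 normr0 !mul0r.
Qed.

Variable eta : probability (borel_wball X) R.

(** [weight_norm] takes the finite part of an integral, which would be 0 for an infinite one.
    Boundedness on the compact ball excludes this. *)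
Lemma weight_integral_fin n (lam : 'I_n -> R) (x : 'I_n -> forall j, X j) :
  (\int[eta]_phi (`|weight sigma lam x phi| `^ q)%:E)%E \is a fin_num.
Proof.
have cw := @continuous_weight_powR n lam x.
have /set_mem[M wM] := continuous_bounded (@wball_compact _ _ X) cw.
rewrite ge0_fin_numE; last by apply: integral_ge0 => phi _; rewrite lee_fin powR_ge0.
apply: (@le_lt_trans _ _ (\int[eta]_phi (cst M%:E phi))%E).
  apply: ge0_le_integral => //.
  - by apply/measurable_EFinP; exact: continuous_borel_measurable cw.
  - by move=> phi _; rewrite lee_fin (le_trans (ler_norm _)).
have eT : eta setT = 1%E := probability_setT eta.
by rewrite integral_cst// [X in (_ * X)%E]eT mule1 ltry.
Qed.

Lemma weight_norm_powR n (lam : 'I_n -> R) (x : 'I_n -> forall j, X j) :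
  ((weight_norm p sigma eta lam x `^ q)%:E =
    \int[eta]_phi (`|weight sigma lam x phi| `^ q)%:E)%E.
Proof.
rewrite /weight_norm -[(1 - sigma) / p]invf_div powRVK ?gt_eqF ?exponent_gt0//.
  by rewrite fineK// weight_integral_fin.
by apply: fine_ge0; apply: integral_ge0 => phi _; rewrite lee_fin powR_ge0.
Qed.

End WeightNorm.

(** * Domination and factorable strong continuity *)

Section Pietsch.
Variables (R : realType) (m : nat) (X : 'I_m -> completeNormedModType R).
Variables (Y : normedModType R) (T : (forall j, X j) -> Y) (p sigma : R).
Hypotheses (p1 : 1 <= p) (sigma1 : sigma < 1).
Let q := p / (1 - sigma).
Local Notation wball := (wball X).

Let q0 : 0 < q.
Proof. exact: exponent_gt0. Qed.

Let q_neq0 : q != 0.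
Proof. by rewrite gt_eqF. Qed.

Let qV : (1 - sigma) / p = q^-1.
Proof. by rewrite invf_div. Qed.

Let le_powR (r x y : R) : 0 <= r -> 0 <= x -> x <= y -> x `^ r <= y `^ r.
Proof.
by move=> r0 x0 xy; rewrite ge0_ler_powR ?nnegrE// (le_trans x0).
Qed.

Definition dominated (C : R) (eta : probability (borel_wball X) R) :=
  forall n (lam : 'I_n -> R) (x : 'I_n -> forall j, X j),
    `|\sum_(k < n) lam k *: T (x k)| <= C * weight_norm p sigma eta lam x.

(** Sum the [q]-th powers of the domination inequalities, exchange sum and integral, and bound the
    integrand by its supremum, [eta] having mass 1. *)
Lemma dominated_strongly_factorable C eta :
  0 < C -> dominated C eta -> strongly_factorable p sigma T.
Proof.
move=> C0 TC; exists C => // n1 n2 lam x; rewrite qV -/q.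
pose W phi := \sum_(i < n1) `|weight sigma (lam i) (x i) phi| `^ q.
set S := sup _.
have W0 phi : 0 <= W phi by apply: sumr_ge0 => i _; exact: powR_ge0.
have cW : continuous (W : wball -> R).
  move=> phi; have FF := @nbhs_filter wball phi.
  apply: cvg_big => [|i _]; first exact: add_continuous.
  exact: continuous_weight_powR.
have WVS phi : W phi `^ q^-1 <= S.
  (* The supremum is a genuine upper bound because a continuous function on the compact ball is
     bounded. *)
  apply: ub_le_sup; last by exists phi.
  have /set_mem[M WM] := continuous_bounded (@wball_compact _ _ X) cW.
  exists (M `^ q^-1) => _ [psi _ <-]; apply: (le_powR _ (W0 psi)).
    by rewrite invr_ge0 ltW.
  exact: le_trans (ler_norm _) (WM psi).
have S0 : 0 <= S by apply: le_trans (WVS point); exact: powR_ge0.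
have WS phi : W phi <= S `^ q.
  rewrite -[leLHS](@powRVK _ _ q)//; apply: le_powR => //; first exact: ltW.
  exact: powR_ge0.
have sum_le : \sum_(i < n1) `|\sum_(k < n2) lam i k *: T (x i k)| `^ q <= (C * S) `^ q.
  rewrite powRM ?(ltW C0)// -lee_fin EFinM.
  apply: (@le_trans _ _ ((C `^ q)%:E * \int[eta]_phi (W phi)%:E)%E).
    under eq_integral do rewrite -sumEFin.
    rewrite ge0_integral_sum//; last first.
      move=> i; apply/measurable_EFinP.
      exact: continuous_borel_measurable (@continuous_weight_powR _ _ _ _ _ p1 sigma1 _ _ _).
    rewrite -sumEFin ge0_sume_distrr; last first.
      by move=> i _; apply: integral_ge0 => phi _; rewrite lee_fin powR_ge0.
    apply: lee_sum => i _; rewrite -(weight_norm_powR p1 sigma1) -EFinM lee_fin.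
    rewrite -powRM ?powR_ge0 ?(ltW C0)//; apply: le_powR; [exact: ltW|exact: normr_ge0|exact: TC].
  rewrite lee_wpmul2l ?lee_fin ?powR_ge0//.
  apply: (@le_trans _ _ (\int[eta]_phi (cst (S `^ q)%:E phi))%E).
    apply: ge0_le_integral => //.
    - by move=> phi _; rewrite lee_fin W0.
    - by apply/measurable_EFinP; exact: continuous_borel_measurable cW.
    - by move=> phi _; rewrite lee_fin WS.
  have eT : eta setT = 1%E := probability_setT eta.
  by rewrite integral_cst// [X in (_ * X)%E]eT mule1.
rewrite -[leRHS](@powRK _ _ q) ?mulr_ge0 ?(ltW C0)//; apply: le_powR => //.
  by rewrite invr_ge0 ltW.
by apply: sumr_ge0 => i _; exact: powR_ge0.
Qed.

Lemma strongly_factorable_dominated : strongly_factorable p sigma T ->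
  exists (C : R) (eta : probability (borel_wball X) R),
    [/\ 0 < C, regular_measure eta & dominated C eta].
Proof.
move=> [C C0]; rewrite qV -/q => TC.
(* Indices are all finite formal combinations; |y i|^q is to be dominated by the integral of C^q |w
   i|^q. *)
pose I := {n : nat & ('I_n -> R) * ('I_n -> forall j, X j)}%type.
pose w (i : I) phi := weight sigma (projT2 i).1 (projT2 i).2 phi.
pose y (i : I) : Y := \sum_(k < projT1 i) (projT2 i).1 k *: T ((projT2 i).2 k).
have [ | | |eta [reta etaP]] := @exists_dominating_probability R wball
  (@wball_hausdorff _ _ X) (@wball_compact _ _ X) I
  (fun i phi => C `^ q * `|w i phi| `^ q) (fun i => `|y i| `^ q).
- move=> i phi; have FF := @nbhs_filter wball phi.
  by apply: cvgM; [exact: cvg_cst|exact: continuous_weight_powR].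
- by move=> i phi; rewrite mulr_ge0 ?powR_ge0.
- move=> s b s0 sb.
  pose r := tnth (in_tuple s).
  have r0 i : 0 <= (r i).1 by apply: (allP s0); exact: mem_tnth.
  pose N := \max_(i < size s) projT1 (r i).2.
  have rN i : (projT1 (r i).2 <= N)%N by exact: leq_bigmax.
  (* Both sides are homogeneous of degree [q] in each row, so a multiplier t of the combination [s]
     enters the coefficients as t^(1/q). *)
  have := TC _ _ (fun i (k : 'I_N) => (r i).1 `^ q^-1 * pad 0 (projT2 (r i).2).1 k)
    (fun i k => pad (fun=> 0) (projT2 (r i).2).2 k).
  have scale_powR i (z : R) : 0 <= z -> ((r i).1 `^ q^-1 * z) `^ q = (r i).1 * z `^ q.
    by move=> z0; rewrite powRM ?powR_ge0// powRVK.
  have rq i : `|(r i).1 `^ q^-1| = (r i).1 `^ q^-1 by rewrite ger0_norm ?powR_ge0.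
  under eq_bigr do rewrite lincomb_pad// normrZ rq scale_powR//.
  set A := \sum_(i < _) _; set S := sup _ => AS.
  have A0 : 0 <= A by apply: sumr_ge0 => i _; rewrite mulr_ge0 ?powR_ge0.
  pose W phi := \sum_(i < size s) (r i).1 * `|w (r i).2 phi| `^ q.
  have W0 phi : 0 <= W phi by apply: sumr_ge0 => i _; rewrite mulr_ge0 ?powR_ge0.
  have WA phi : C `^ q * W phi <= A + b.
    rewrite -lerBlDl (le_trans _ (sb phi))// big_tnth mulr_sumr -sumrB.
    by apply: ler_sum => i _; rewrite mulrBr mulrCA.
  have Ab0 : 0 <= A + b by apply: le_trans (WA point); rewrite mulr_ge0 ?powR_ge0.
  (* Every element of the set under [sup], times [C], is at most the 1/q-th power of [A + b]; with
     (1) this gives [A <= A + b]. *)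
  have SA : C * S <= (A + b) `^ q^-1.
    rewrite mulrC -ler_pdivlMr//; apply: ge_sup.
      by apply: image_nonempty; exists point.
    move=> _ [phi _ <-]; rewrite ler_pdivlMr// mulrC.
    under eq_bigr do rewrite weight_pad// normrM normr_id rq scale_powR//.
    rewrite -[X in X * _](@powRK _ _ q) ?(ltW C0)// -powRM ?powR_ge0//; last exact: W0.
    apply: le_powR; [by rewrite invr_ge0 ltW| |exact: WA].
    by rewrite mulr_ge0 ?powR_ge0//; exact: W0.
  have : (A `^ q^-1) `^ q <= ((A + b) `^ q^-1) `^ q.
    by apply: le_powR; [exact: ltW|exact: powR_ge0|exact: le_trans AS SA].
  by rewrite !powRVK// lerDl.
exists C, eta; split => // n lam x.
have := etaP (existT _ n (lam, x)).
under eq_integral do rewrite EFinM.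
rewrite ge0_integralZl ?lee_fin ?powR_ge0//; last first.
  apply/measurable_EFinP.
  exact: continuous_borel_measurable (@continuous_weight_powR _ _ _ _ _ p1 sigma1 _ _ _).
rewrite -(weight_norm_powR p1 sigma1) -EFinM lee_fin -powRM ?powR_ge0 ?(ltW C0)//.
move=> /(le_powR _ (powR_ge0 _ _)) => /(_ q^-1).
rewrite !powRK ?mulr_ge0 ?powR_ge0 ?(ltW C0)//; apply; rewrite invr_ge0; exact: ltW.
Qed.

End Pietsch.

(** * The cycle of implications between the three assertions *)

Theorem theorem4p7 (R : realType) (m : nat) (m_gt0 : (0 < m)%N)
    (X : 'I_m -> completeNormedModType R) (Y : completeNormedModType R)
    (p sigma : R) (p1 : 1 <= p) (sigma0 : 0 <= sigma) (sigma1 : sigma < 1)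
    (T : (forall j, X j) -> Y) (T_mult : continuous_multilinear T) :
  [<-> strongly_factorable p sigma T;
       exists (C : R) (eta : probability (borel_wball X) R),
         [/\ 0 < C, regular_measure eta &
          forall n (lam : 'I_n -> R) (x : 'I_n -> forall j, X j),
            `|\sum_(k < n) lam k *: T (x k)|
              <= C * weight_norm p sigma eta lam x];
       exists eta : probability (borel_wball X) R,
         regular_measure eta /\
         exists That : {linear Lpsigma eta p1 sigma1 -> Y},
           continuous That /\
           forall x : forall j, X j, T x = That (ipsigma eta p1 sigma1 (imap x))].
Proof.
tfae.
- move=> /(strongly_factorable_dominated p1 sigma1)[C [eta [C0 reta TC]]].
  by exists C, eta.
- move=> [C [eta [C0 reta TC]]]; exists eta; split => //.
  have [S ST] := tensor_lift m_gt0 T_mult.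
  have SE n (lam : 'I_n -> R) x :
      S (\sum_(k < n) lam k *: imap (x k)) = \sum_(k < n) lam k *: T (x k).
    by rewrite raddf_sum; apply: eq_bigr => k _; rewrite -ST; exact: linearZ.
  (* Domination bounds each block of a representation of [v]; the triangle inequality sums the
     blocks, and the infimum over representations gives the seminorm. *)
  have SC v : `|S v| <= C * dom_norm eta p1 sigma1 v.
    rewrite -ler_pdivrMl//; apply: lb_le_inf; first exact: dom_cost_ex.
    move=> _ [r [s [lam [x [-> ->]]]]]; rewrite ler_pdivrMl// mulr_sumr.
    rewrite raddf_sum (le_trans (ler_norm_sum _ _ _))//; apply: ler_sum => i _.
    by have := TC s (lam i) (x i); rewrite -SE.
  have [That [Thatc ThatE]] := completion_extend SC.
  by exists That; split => // x; rewrite ThatE.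
- move=> [eta [reta [That [Thatc TE]]]].
  have /linear_bounded_continuous/linear_boundedP/pinfty_ex_gt0[M M0 ThatM] := Thatc.
  (* The inequality of (2) is recovered with the same [eta], the operator bound [M] of [That]
     serving as the constant. *)
  apply: (dominated_strongly_factorable p1 sigma1 M0 (eta := eta)) => n lam x.
  have -> : \sum_(k < n) lam k *: T (x k) =
      That (ipsigma eta p1 sigma1 (\sum_(k < n) lam k *: imap (x k))).
    rewrite /ipsigma !raddf_sum; apply: eq_bigr => k _.
    rewrite TE; transitivity (That (lam k *: cembed (dom_norm eta p1 sigma1) (imap (x k)))).
      exact/esym/linearZ.
    by congr (That _); exact/esym/linearZ.
  rewrite (le_trans (ThatM _))// ler_wpM2l ?(ltW M0)// cembed_norm.
  apply: ge_inf; first by exists 0 => c; exact: dom_cost_ge0.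
  by exists 1%N, n, (fun=> lam), (fun=> x); rewrite !big_ord1.
Qed.
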